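(* Let $T>0$, let $\rho_0:\mathbb T\to[0,1]$ be piecewise continuous, and for each $\alpha>0$ let $\rho^\alpha:[0,T]\times[0,1]\to[0,1]$ be the unique weak solution of the heat equation with Robin's boundary conditions with parameter $\alpha$ and initial condition $\rho_0$. Then $$\lim_{\alpha\to 0}\rho^\alpha=\rho^0\qquad\text{and}\qquad \lim_{\alpha\to\infty}\rho^\alpha=\rho^\infty$$ in $L^2([0,T]\times[0,1])$, where $\rho^0$ is the unique weak solution of the heat equation with Neumann's boundary conditions with initial condition $\rho_0$, and $\rho^\infty$ is the unique weak solution of the heat equation with periodic boundary conditions with initial condition $\rho_0$.
   Context: $\mathbb T=\mathbb R/\mathbb Z$ is the continuous torus; functions on $\mathbb T$ and on $[0,1]$ are identified Lebesgue almost everywhere. A subindex $t$ denotes the time variable: $\rho_t(u)=\rho(t,u)$. $\langle\cdot,\cdot\rangle$ is the inner product of $L^2[0,1]$ (or $L^2(\mathbb T)$). $\Delta=\partial_u^2$. $C^{n,m}(A\times B)$ is the space of real functions on $A\times B$ of class $C^n$ in the first variable and $C^m$ in the second (with the corresponding derivatives continuous on $A\times B$). $\mathcal H^1$ is the set of locally summable $\zeta:[0,1]\to\mathbb R$ for which there is $\partial_u\zeta\in L^2[0,1]$ with $\langle\partial_uG,\zeta\rangle=-\langle G,\partial_u\zeta\rangle$ for all $G\in C^\infty(0,1)$ with compact support, with norm $\|\zeta\|_{\mathcal H^1}=(\|\zeta\|_{L^2[0,1]}^2+\|\partial_u\zeta\|_{L^2[0,1]}^2)^{1/2}$. $L^2(0,T;\mathcal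 H^1)$ is the space of measurable $\xi:[0,T]\to\mathcal H^1$ with $\int_0^T\|\xi_t\|_{\mathcal H^1}^2dt<\infty$ (as usual, $\xi_t\in\mathcal H^1$ for almost every $t$). For $\zeta\in\mathcal H^1$, $\zeta(0),\zeta(1)$ are the boundary values of its continuous representative. Weak solutions (below, $\rho_0$ is the given initial condition, and $\rho_t\in L^2$ for every $t$): Robin (parameter $\alpha>0$; the equation $\partial_t\rho=\Delta\rho$ on $(0,1)$, $\partial_u\rho(t,0)=\partial_u\rho(t,1)=\alpha(\rho(t,0)-\rho(t,1))$, $\rho(0,\cdot)=\rho_0$): $\rho\in L^2(0,T;\mathcal H^1)$ and for all $t\in[0,T]$, $H\in C^{1,2}([0,T]\times[0,1])$, $$\langle\rho_t,H_t\rangle-\langle\rho_0,H_0\rangle-\int_0^t\langle\rho_s,\partial_sH_s+\Delta H_s\rangle ds-\int_0^t(\rho_s(0)\partial_uH_s(0)-\rho_s(1)\partial_uH_s(1))ds+\int_0^t\alpha(\rho_s(0)-\rho_s(1))(H_s(0)-H_s(1))ds=0.$$ Neumann ($\partial_t\rho=\Delta\rho$ on $(0,1)$, $\partial_u\rho(t,0)=\partial_u\rho(t,1)=0$, $\rho(0,\cdot)=\rho_0$): $\rho\in L^2(0,T;\mathcal H^1)$ and for all $t\in[0,T]$, $H\in C^{1,2}([0,T]\times[0,1])$, $$\langle\rho_t,H_t\rangle-\langle\rho_0,H_0\rangle-\int_0^t\langle\rho_s,\partial_sH_s+\Delta H_s\rangle ds-\int_0^t(\rho_s(0)\partial_uH_s(0)-\rho_s(1)\partial_uH_s(1))ds=0.$$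 Periodic ($\partial_t\rho=\Delta\rho$ on $\mathbb T$, $\rho(0,\cdot)=\rho_0$): $\rho$ is measurable and for all $t\in[0,T]$, $H\in C^{1,2}([0,T]\times\mathbb T)$, $\langle\rho_t,H_t\rangle-\langle\rho_0,H_0\rangle-\int_0^t\langle\rho_s,\partial_sH_s+\Delta H_s\rangle ds=0$. *)

(* Defs.v *)
From HB Require Import structures.
From mathcomp Require Import all_boot all_order all_algebra.
From mathcomp Require Import all_classical all_reals all_analysis.

Set Implicit Arguments.
Unset Strict Implicit.
Unset Printing Implicit Defensive.

Import Order.TTheory GRing.Theory Num.Theory.
Import numFieldNormedType.Exports.

Local Open Scope classical_set_scope.
Local Open Scope ring_scope.

(* Functions on [0,1] (resp. [0,T] x [0,1]) are total functions R -> R (resp.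
   R -> R -> R, time first) of which only the values on [0,1] (resp.
   [0,T] x [0,1]) matter.  Functions on the torus R/Z that have to be known
   pointwise (initial conditions, test functions) are 1-periodic functions on
   R; solutions on the torus are identified a.e. with functions on [0,1].
   "Measurable" is Borel measurability: an a.e. class of Lebesgue measurable
   functions is represented by a Borel member. *)

Section Spaces.
Context {R : realType}.
Implicit Types (f g z G : R -> R) (xi : R -> R -> R).

Local Notation mu := (@lebesgue_measure R).

Definition unitI : set R := `[0, 1].

Definition timeI (T : R) : set R := `[0, T].

Definition inner f g : R := \int[mu]_(u in unitI) (f u * g u).

Definition L2 f : Prop := (f \_ unitI) \in Lfun mu 2%:E.

Definition normL2 f : \bar R := ('N[mu]_2%:E[EFin \o (f \_ unitI)])%E.

Definition smooth_compact G : Prop :=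
  [/\ forall n u, derivable (derive1n n G) u 1,
      compact (closure [set u | G u != 0]) &
      closure [set u | G u != 0] `<=` `]0, 1[%classic].

Definition weak_derivative z g : Prop :=
  L2 g /\ forall G, smooth_compact G -> inner (derive1 G) z = - inner G g.

Definition H1 z : Prop :=
  locally_integrable `]0, 1[%classic z /\ exists g, weak_derivative z g.

(* A choice among a.e. equal functions. *)
Definition wderiv z : R -> R := xget (fun=> 0) [set g | weak_derivative z g].

Definition normH1 z : \bar R :=
  ((normL2 z ^+ 2 + normL2 (wderiv z) ^+ 2) `^ 2^-1)%E.

(* Trace of the open subsets of the normed space H1; U need not be a subset
   of H1. *)
Definition H1_open (U : set (R -> R)) : Prop :=
  forall z, H1 z -> U z ->
  exists2 e : R, 0 < e &
    forall w, H1 w -> (normH1 (fun u => (w u - z u)%R) < e%:E)%E -> U w.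

(* The first clause makes xi a measurable function on [0,T] x [0,1], whose
   L^2([0,T] x [0,1]) distance to other functions is meaningful; the third one
   is Borel measurability of t |-> xi t as an H1-valued map, defined a.e. *)
Definition L2H1 (T : R) xi : Prop :=
  [/\ measurable_fun (timeI T `*` unitI) (fun x : R * R => xi x.1 x.2),
      {ae mu, forall t, timeI T t -> H1 (xi t)},
      forall U, H1_open U ->
        measurable [set t | [/\ timeI T t, H1 (xi t) & U (xi t)]] &
      (\int[mu]_(t in timeI T) (normH1 (xi t) ^+ 2) < +oo)%E].

(* The continuous representative of z on [0,1]. *)
Definition cont_rep z : R -> R :=
  xget (fun=> 0) [set f | {within unitI, continuous f} /\
                          {ae mu, forall u, unitI u -> f u = z u}].

Definition deriv_on (D : set R) f (x l : R) : Prop :=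
  (fun y => (f y - f x) / (y - x)) @ within D x^' --> l.

Definition jcontinuous (A B : set R) (F : R -> R -> R) : Prop :=
  {within A `*` B, continuous (fun x : R * R => F x.1 x.2)}.

(* H is of class C^1 in time and C^2 in space on A x B, with derivatives
   Hs = d_s H, Hu = d_u H, Huu = d_u^2 H, one-sided at the endpoints of A
   and B. *)
Definition C12 (A B : set R) (H Hs Hu Huu : R -> R -> R) : Prop :=
  [/\ [/\ jcontinuous A B H, jcontinuous A B Hs, jcontinuous A B Hu &
          jcontinuous A B Huu],
      forall s u, A s -> B u -> deriv_on A (fun r => H r u) s (Hs s u),
      forall s u, A s -> B u -> deriv_on B (H s) u (Hu s u) &
      forall s u, A s -> B u -> deriv_on B (Hu s) u (Huu s u)].

Definition piecewise_continuous_torus f : Prop :=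
  [/\ periodic f 1,
      forall u, cvg (f x @[x --> u^'-]),
      forall u, cvg (f x @[x --> u^'+]) &
      exists s : seq R, forall u, 0 <= u < 1 -> u \notin s ->
        f x @[x --> u] --> f u].

End Spaces.

Section WeakSolutions.
Context {R : realType}.
Variables (T : R) (rho0 : R -> R).
Implicit Types (rho H Hs Hu Huu : R -> R -> R).

Local Notation mu := (@lebesgue_measure R).

Definition bulk_terms rho H Hs Huu (t : R) : R :=
  inner (rho t) (H t) - inner rho0 (H 0)
  - \int[mu]_(s in timeI t) inner (rho s) (fun u => Hs s u + Huu s u).

Definition boundary_terms rho Hu (t : R) : R :=
  \int[mu]_(s in timeI t)
    (cont_rep (rho s) 0 * Hu s 0 - cont_rep (rho s) 1 * Hu s 1).

Definition robin_terms (a : R) rho H (t : R) : R :=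
  \int[mu]_(s in timeI t)
    (a * (cont_rep (rho s) 0 - cont_rep (rho s) 1) * (H s 0 - H s 1)).

Definition weak_robin (a : R) rho : Prop :=
  [/\ forall t, 0 <= t <= T -> L2 (rho t),
      L2H1 T rho &
      forall t H Hs Hu Huu, 0 <= t <= T -> C12 (timeI T) unitI H Hs Hu Huu ->
        bulk_terms rho H Hs Huu t - boundary_terms rho Hu t
        + robin_terms a rho H t = 0].

Definition weak_neumann rho : Prop :=
  [/\ forall t, 0 <= t <= T -> L2 (rho t),
      L2H1 T rho &
      forall t H Hs Hu Huu, 0 <= t <= T -> C12 (timeI T) unitI H Hs Hu Huu ->
        bulk_terms rho H Hs Huu t - boundary_terms rho Hu t = 0].

Definition weak_periodic rho : Prop :=
  [/\ forall t, 0 <= t <= T -> L2 (rho t),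
      measurable_fun (timeI T `*` unitI) (fun x : R * R => rho x.1 x.2) &
      forall t H Hs Hu Huu, 0 <= t <= T -> C12 (timeI T) setT H Hs Hu Huu ->
        (forall s, 0 <= s <= T -> periodic (H s) 1) ->
        bulk_terms rho H Hs Huu t = 0].

Definition distL2 rho (rho' : R -> R -> R) : \bar R :=
  ('N[mu \x mu]_2%:E[EFin \o
      ((fun x : R * R => (rho x.1 x.2 - rho' x.1 x.2)%R)
         \_ (timeI T `*` unitI))])%E.

End WeakSolutions.

(* Main.v *)
(* Testing with e^{l(s-t)} cos(pi k u), l = (pi k)^2, kills the bulk and the
   boundary terms, so the k-th cosine coefficient of rho^a_t - rho^0_t is a
   times an integral of the jump rho^a_s(0) - rho^a_s(1), which is at most 1 in
   absolute value.  It is therefore O(a / k^2).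

   For the limit a -> +oo, testing with e^{l(s-t)} cos(2 pi n u) shows that the
   cosine coefficients of rho^a_t and rho^oo_t coincide.  Testing with
   e^{l(s-t)} sin(2 pi n u) bounds the difference of the sine coefficients by
   O(1 / n), while adding the corrector (pi n / a) cos(pi u), which makes the
   Robin boundary conditions exact, bounds it by O(n / a).

   The coefficient bounds are summed by Bessel's identity and the completeness
   of both trigonometric systems.  Completeness holds because each span is an
   algebra containing, for every c in (0, 1), a function p with |p| <= 1 which
   changes sign exactly at c: the polynomial iterates converging to sgn(p) put
   the indicators of half-lines in the closure of the algebra, hence those of
   all Borel sets, hence all of L^2. *)
Require Import Defs.
From HB Require Import structures.
From mathcomp Require Import all_boot all_order all_algebra finmap.
From mathcomp Require Import all_classical all_reals all_analysis.
From mathcomp Require Import measurable_realfun zify ring lra.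

Import Order.TTheory GRing.Theory Num.Theory.
Import numFieldNormedType.Exports.

Set Implicit Arguments.
Unset Strict Implicit.
Unset Printing Implicit Defensive.

Local Open Scope classical_set_scope.
Local Open Scope ring_scope.

(** * Mean-square closure of a family of functions on [0,1] *)

Section MeanSquareApproximation.
Context {R : realType}.
Implicit Types (f g h p : R -> R) (A : set (R -> R)).

Local Notation mu := (@lebesgue_measure R).

Definition sqdist f g : \bar R :=
  (\int[mu]_(u in unitI) ((f u - g u) ^+ 2)%:E)%E.

(** The L^2(0,1) closure of [A], with measurability of the limit carried along so that the closure
    properties below compose. *)
Definition approximable A f : Prop :=
  measurable_fun setT f /\
  forall e : R, 0 < e -> exists2 p, A p & (sqdist f p <= e%:E)%E.

Lemma measurable_unitI : measurable (@unitI R).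
Proof. exact: measurable_itv. Qed.

Lemma measurable_sqrB (D : set R) f g : measurable_fun D f -> measurable_fun D g ->
  measurable_fun D (EFin \o (fun u => (f u - g u) ^+ 2)).
Proof.
move=> mf mg; apply/measurable_EFinP; apply: measurable_funX.
exact: measurable_funB.
Qed.

Lemma sqdistxx f : sqdist f f = 0%E.
Proof. by rewrite /sqdist; apply: integral0_eq => u _; rewrite subrr expr0n. Qed.

(** Pointwise [(x + y) ^+ 2 <= 2 * x ^+ 2 + 2 * y ^+ 2]; this serves as a triangle inequality free
    of square roots. *)
Lemma sqdist_lin f f' g g' (a : R) :
  measurable_fun setT f -> measurable_fun setT f' ->
  measurable_fun setT g -> measurable_fun setT g' ->
  (sqdist (fun u => f u + a * g u)%R (fun u => f' u + a * g' u)%R <=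
   2%:E * sqdist f f' + (2 * a ^+ 2)%:E * sqdist g g')%E.
Proof.
move=> mf mf' mg mg'; rewrite /sqdist.
have mS h h' : measurable_fun setT h -> measurable_fun setT h' ->
    measurable_fun (unitI) (EFin \o (fun u => (h u - h' u) ^+ 2)).
  by move=> mh mh'; apply: measurable_sqrB; exact: measurable_funTS.
have ge0 b h h' : 0 <= b ->
    forall u, unitI u -> (0 <= b%:E * ((h u - h' u) ^+ 2)%:E :> \bar R)%E.
  by move=> b0 u _; rewrite -EFinM lee_fin mulr_ge0 ?sqr_ge0.
have a0 : 0 <= 2 * a ^+ 2 by rewrite mulr_ge0 ?sqr_ge0.
rewrite -!ge0_integralZl//; try (by move=> u _; rewrite lee_fin sqr_ge0);
  try exact: measurable_unitI; try exact: mS.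
rewrite -ge0_integralD//; try exact: measurable_unitI; try exact: ge0;
  try (by apply: emeasurable_funM => //; exact: mS).
apply: ge0_le_integral; try exact: measurable_unitI.
- by move=> u _; rewrite lee_fin sqr_ge0.
- apply: mS; apply: measurable_funD => //; exact: measurable_funM.
- by apply: emeasurable_funD; apply: emeasurable_funM => //; exact: mS.
- move=> u _; rewrite -!EFinM -EFinD lee_fin.
  set x := f u - f' u; set y := a * (g u - g' u).
  have -> : f u + a * g u - (f' u + a * g' u) = x + y by rewrite /x /y; ring.
  have -> : 2 * a ^+ 2 * (g u - g' u) ^+ 2 = 2 * y ^+ 2 by rewrite /y; ring.
  have := sqr_ge0 (x - y); nra.
Qed.

Lemma approximable_sub A f : A `<=` [set p | measurable_fun setT p] ->
  A f -> approximable A f.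
Proof.
move=> mA Af; split=> [|e e0]; first exact: mA.
by exists f => //; rewrite sqdistxx lee_fin ltW.
Qed.

Lemma approximable_lin A f g (a : R) :
  A `<=` [set p | measurable_fun setT p] ->
  (forall p q (b : R), A p -> A q -> A (fun u => p u + b * q u)) ->
  approximable A f -> approximable A g ->
  approximable A (fun u => f u + a * g u).
Proof.
move=> mA linA [mf af] [mg ag]; split=> [|e e0].
  by apply: measurable_funD => //; exact: measurable_funM.
have e4 : 0 < e / 4 by rewrite divr_gt0.
(* The summand [1] keeps the divisor positive when [a = 0]. *)
have a1 : 0 < 1 + 2 * a ^+ 2 by have := sqr_ge0 a; lra.
have ea : 0 < e / 2 / (1 + 2 * a ^+ 2) by rewrite !divr_gt0.
have [p Ap fp] := af _ e4; have [q Aq gq] := ag _ ea.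
exists (fun u => p u + a * q u); first exact: linA.
apply: le_trans (sqdist_lin a mf (mA _ Ap) mg (mA _ Aq)) _.
have a0 : 0 <= 2 * a ^+ 2 by rewrite mulr_ge0 ?sqr_ge0.
apply: (@le_trans _ _ (2%:E * (e / 4)%:E +
    (2 * a ^+ 2)%:E * (e / 2 / (1 + 2 * a ^+ 2))%:E)%E).
  by apply: leeD; apply: lee_wpmul2l.
rewrite -!EFinM -EFinD lee_fin.
have -> : 2 * a ^+ 2 * (e / 2 / (1 + 2 * a ^+ 2)) =
    e / 2 * (2 * a ^+ 2 / (1 + 2 * a ^+ 2)) by field; rewrite gt_eqF.
have : 2 * a ^+ 2 / (1 + 2 * a ^+ 2) <= 1 by rewrite ler_pdivrMr//; lra.
nra.
Qed.

Lemma approximable_trans A f (f_ : nat -> R -> R) :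
  A `<=` [set p | measurable_fun setT p] ->
  measurable_fun setT f -> (forall n, approximable A (f_ n)) ->
  (forall e : R, 0 < e -> exists n, (sqdist f (f_ n) <= e%:E)%E) ->
  approximable A f.
Proof.
move=> mA mf af cvf; split=> // e e0.
have e4 : 0 < e / 4 by rewrite divr_gt0.
have [n fn] := cvf _ e4; have [mfn /(_ _ e4)[p Ap fp]] := af n.
exists p => //.
have := sqdist_lin 1 mf mfn mfn (mA _ Ap).
(* Adding [f_ n] to both arguments in crossed order turns [sqdist_lin] into a triangle inequality
   through [f_ n]. *)
have -> : sqdist (fun u => f u + 1 * f_ n u) (fun u => f_ n u + 1 * p u) =
    sqdist f p by apply: eq_integral => u _; congr (_%:E); ring.
move=> /le_trans; apply.
apply: (@le_trans _ _ (2%:E * (e / 4)%:E + (2 * 1 ^+ 2)%:E * (e / 4)%:E)%E).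
  by apply: leeD; apply: lee_wpmul2l => //; rewrite lee_fin.
by rewrite -!EFinM -EFinD lee_fin; lra.
Qed.

(** Dominated convergence for [(f - f_ n) ^+ 2], which is at most [4 * g ^+ 2]. *)
Lemma approximable_cvg A f (f_ : nat -> R -> R) g :
  A `<=` [set p | measurable_fun setT p] ->
  measurable_fun setT f -> (forall n, approximable A (f_ n)) ->
  {ae mu, forall u, unitI u -> f_ ^~ u @ \oo --> f u} ->
  mu.-integrable unitI (fun u => (g u ^+ 2)%:E) ->
  (forall u, unitI u -> `|f u| <= g u) ->
  (forall n u, unitI u -> `|f_ n u| <= g u) ->
  approximable A f.
Proof.
move=> mA mf af cvf ig fg f_g; apply: (approximable_trans mA mf af) => e e0.
pose F n u := ((f u - f_ n u) ^+ 2)%:E.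
have mF n : measurable_fun unitI (F n).
  by apply: measurable_sqrB; apply: measurable_funTS => //; case: (af n).
have [|||||_ _] := @dominated_convergence _ _ R mu _ measurable_unitI F (cst 0%E)
    (fun u => 4%:E * (g u ^+ 2)%:E)%E.
- exact: mF.
- exact: measurable_cst.
- apply: negligibleS cvf; apply: subsetC => u /= cvu Iu; rewrite /F.
  apply: cvg_EFin; first by near=> n.
  have -> : fine \o (fun n => ((f u - f_ n u) ^+ 2)%:E) =
    (fun n => (f u - f_ n u) ^+ 2) by [].
  rewrite [X in _ --> X](_ : _ = (f u - f u) * (f u - f u)); last first.
    by rewrite subrr mulr0.
  under eq_fun do rewrite expr2.
  by apply: cvgM; apply: cvgB; (try exact: cvg_cst); exact: cvu.
- by apply: integrableZl => //; exact: measurable_unitI.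
- apply: nearW => u n Iu; rewrite /F -EFinM gee0_abs ?lee_fin ?sqr_ge0//.
  have := fg _ Iu; have := f_g n _ Iu; rewrite !ler_norml.
  move=> /andP[] ? ? /andP[] ? ?; nra.
rewrite (@integral0_eq _ _ _ _ _ (cst 0%E))//.
move=> /fine_cvgP[] fin /cvgrPdist_le /(_ _ e0) cv.
have [n [+ /=]] := filter_ex (filterI fin cv).
rewrite sub0r normrN => fn le_e; exists n.
have := le_trans (ler_norm _) le_e.
by rewrite -lee_fin fineK.
Unshelve. all: by end_near. Qed.

End MeanSquareApproximation.

(** * Polynomial iteration converging to the sign *)

Section SignIteration.
Context {R : realType}.

(* A polynomial, so that its iterates preserve function algebras; on [-1, 1]
   they converge to the sign function. *)
Definition sign_step (x : R) : R := x * (3 - x ^+ 2) / 2.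

Lemma iter_sign_stepN n x : iter n sign_step (- x) = - iter n sign_step x.
Proof. by elim: n => //= n ->; rewrite /sign_step; ring. Qed.

(** The iterates increase, and each step multiplies the distance to 1 by [(1 - y) * (y + 2) / 2],
    which is at most [1 - x / 2] as long as [x <= y <= 1]. *)
Lemma iter_sign_step_gt0 n (x : R) : 0 < x <= 1 ->
  [/\ x <= iter n sign_step x, iter n sign_step x <= 1 &
      1 - iter n sign_step x <= (1 - x / 2) ^+ n].
Proof.
move=> /andP[x0 x1]; elim: n => [|n [xy y1 yn]] /=; first by rewrite expr0; split; lra.
set y := iter n sign_step x in xy y1 yn *.
have e1 : sign_step y - y = y * (1 - y ^+ 2) / 2 by rewrite /sign_step; field.
have e2 : 1 - sign_step y = (1 - y) * ((1 - y) * (y + 2) / 2).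
  by rewrite /sign_step; field.
have y2 : 0 <= y * (1 - y ^+ 2) by apply: mulr_ge0; nra.
have e3 : 0 <= (1 - y) * (y + 2) / 2 <= 1 - x / 2 by apply/andP; split; nra.
split; [lra| |].
  by rewrite -subr_ge0 e2; case/andP: e3 => *; rewrite mulr_ge0//; lra.
by rewrite e2 exprSr; case/andP: e3 => *; apply: ler_pM => //; lra.
Qed.

Lemma iter_sign_step_norm n (x : R) : `|x| <= 1 -> `|iter n sign_step x| <= 1.
Proof.
wlog x0 : x / 0 <= x => [W|].
  have [/W//|/ltW xn] := leP 0 x.
  by have := W (- x); rewrite oppr_ge0 iter_sign_stepN !normrN; exact.
rewrite ger0_norm// => x1; move: x0; rewrite le_eqVlt => /predU1P[<-|x0].
  suff -> : iter n sign_step 0 = 0 by rewrite normr0.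
  by elim: n => //= n ->; rewrite /sign_step mul0r mul0r.
have [|a b _] := @iter_sign_step_gt0 n x; first by rewrite x0.
by rewrite ger0_norm//; lra.
Qed.

Lemma cvg_iter_sign_step (x : R) : `|x| <= 1 -> x != 0 ->
  (fun n => iter n sign_step x) @ \oo --> Num.sg x.
Proof.
wlog x0 : x / 0 <= x => [W x1 xn0|].
  have [x0|/ltW xn] := leP 0 x; first exact: W.
  rewrite -(opprK x) sgrN; under eq_fun do rewrite iter_sign_stepN.
  have := W (- x); rewrite oppr_ge0 normrN oppr_eq0 => /(_ xn x1 xn0).
  exact: cvgN.
rewrite ger0_norm// => x1 xn0.
have {xn0}x0 : 0 < x by rewrite lt_def xn0.
rewrite gtr0_sg//.
have B n : [/\ x <= iter n sign_step x, iter n sign_step x <= 1 &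
      1 - iter n sign_step x <= (1 - x / 2) ^+ n].
  by apply: iter_sign_step_gt0; rewrite x0.
apply: (@squeeze_cvgr _ _ _ _ (fun n => 1 - (1 - x / 2) ^+ n) (fun=> 1)).
- by near=> n; have [? ? ?] := B n; apply/andP; split; lra.
- rewrite -[X in _ --> X]subr0; apply: cvgB; first exact: cvg_cst.
  by apply: cvg_expr; rewrite ger0_norm; lra.
- exact: cvg_cst.
Unshelve. all: by end_near. Qed.

End SignIteration.

(** * Density in L^2 of an algebra that detects every threshold *)

Section Density.
Context {R : realType}.
Implicit Types (f g p : R -> R).

Local Notation mu := (@lebesgue_measure R).

Record function_algebra (A : set (R -> R)) : Prop := {
  algebra_measurable : A `<=` [set p | measurable_fun setT p];
  algebra_lin : forall p q (b : R), A p -> A q -> A (fun u => p u + b * q u);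
  algebra_mul : forall p q, A p -> A q -> A (fun u => p u * q u);
  algebra_one : A (fun=> 1) }.

Variable A : set (R -> R).
Hypothesis algA : function_algebra A.

Let mA := algebra_measurable algA.

Lemma algebra_cst (c : R) : A (fun=> c).
Proof.
have := algebra_lin algA (c - 1) (algebra_one algA) (algebra_one algA).
by congr A; apply/funext => u; ring.
Qed.

Lemma algebra_sign_step n p : A p -> A (fun u => iter n sign_step (p u)).
Proof.
move=> Ap; elim: n => //= n; set q := fun u => iter n sign_step (p u) => Aq.
have := algebra_mul algA Aq (algebra_lin algA (-2^-1) (algebra_cst (3 / 2))
  (algebra_mul algA Aq Aq)).
by congr A; apply/funext => u; rewrite /sign_step /q; field.
Qed.

Let approxC c : approximable A (fun=> c).
Proof. exact/approximable_sub/algebra_cst. Qed.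

Let approx_lin f g (a : R) : approximable A f -> approximable A g ->
  approximable A (fun u => f u + a * g u).
Proof. by apply: approximable_lin => // p q b; exact: algebra_lin. Qed.

Lemma integrable_cst_unitI (c : R) :
  mu.-integrable unitI (fun u => (c ^+ 2)%:E).
Proof.
apply/integrableP; split; first exact: measurable_cst.
rewrite integral_cst//= ?/unitI; last exact: measurable_unitI.
rewrite lebesgue_measure_itv/= lte_fin ltr01 -EFinB subr0 mule1.
by rewrite ltry.
Qed.

Lemma ae_unitI (s : seq R) (P : R -> Prop) :
  (forall u, 0 < u < 1 -> u \notin s -> P u) ->
  {ae mu, forall u, unitI u -> P u}.
Proof.
move=> HP; have : mu.-negligible [set` 0 :: 1 :: s].
  have fs : countable [set` 0 :: 1 :: s] by apply: finite_set_countable; exact: finite_seq.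
  apply/negligibleP; last exact: countable_lebesgue_measure0.
  by apply: countable_measurable => // t; exact: measurable_set1.
apply: negligibleS => u /= nP; apply: contrapT => /negP nu; apply: nP.
rewrite /unitI/= in_itv/= => /andP[u0 u1].
move: nu; rewrite !inE !negb_or => /and3P[un0 un1 us]; apply: HP => //.
by rewrite !lt_neqAle u0 u1 un1 eq_sym un0.
Qed.

Hypothesis sepA : forall c : R, 0 < c < 1 -> exists2 p, A p &
  (forall u, `|p u| <= 1) /\
  (forall u, 0 < u < 1 -> (u < c -> 0 < p u) /\ (c < u -> p u < 0)).

(** If [p] changes sign at [c], then [(1 - sg p) / 2] is the indicator of the half-line on (0,1)
    minus the point [c], and it is the pointwise limit of the members of [A] obtained by iterating
    [sign_step] on [p]. *)
Lemma approximable_ray (c : R) : approximable A \1_(`]c, +oo[).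
Proof.
have mR : measurable_fun setT (\1_(`]c, +oo[) : R -> R).
  by apply: measurable_indic; exact: measurable_itv.
have R1 u : unitI u -> `|\1_(`]c, +oo[) u| <= 1 :> R.
  by move=> _; rewrite indicE; case: (_ \in _); rewrite ?normr0 ?normr1.
(* A threshold outside (0,1) gives an indicator that is almost everywhere constant on [0,1]. *)
have [c0|c0] := leP c 0.
  apply: (@approximable_cvg R A _ (fun=> fun=> 1) (fun=> 1)) => //.
  - apply: (@ae_unitI [::]) => u /andP[u0 u1] _.
    rewrite indicE mem_set; first exact: cvg_cst.
    by rewrite /= in_itv/= andbT (le_lt_trans c0).
  - exact: (integrable_cst_unitI 1).
  - by move=> n u _; rewrite normr1.
have [c1|c1] := leP 1 c.
  apply: (@approximable_cvg R A _ (fun=> fun=> 0) (fun=> 1)) => //.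
  - apply: (@ae_unitI [::]) => u /andP[u0 u1] _.
    rewrite indicE memNset; first exact: cvg_cst.
    by rewrite /= in_itv/= andbT => /lt_trans/(_ u1); rewrite ltNge c1.
  - exact: (integrable_cst_unitI 1).
  - by move=> n u _; rewrite normr0.
have [p Ap [p1 pc]] := sepA (introT andP (conj c0 c1)).
apply: (@approximable_cvg R A _ (fun n u => 2^-1 + - 2^-1 * iter n sign_step (p u))
    (fun=> 1)) => //.
- move=> n; apply: approx_lin; first exact: approxC.
  exact/approximable_sub/algebra_sign_step.
- apply: (@ae_unitI [:: c]) => u u01; rewrite inE => uc.
  have [pl pr] := pc _ u01.
  have pu0 : p u != 0.
    by move: uc; rewrite neq_lt => /orP[/pl /gt_eqF ->|/pr /lt_eqF ->].
  rewrite [X in _ --> X](_ : _ = 2^-1 + - 2^-1 * Num.sg (p u)); last first.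
    rewrite indicE; move: uc; rewrite neq_lt => /orP[uc|cu].
      rewrite memNset ?gtr0_sg ?pl//; first by rewrite /=; lra.
      by rewrite /= in_itv/= andbT => /lt_trans/(_ uc); rewrite ltxx.
    rewrite mem_set ?ltr0_sg ?pr//; first by rewrite /=; lra.
    by rewrite /= in_itv/= andbT.
  apply: cvgD; first exact: cvg_cst.
  by apply: cvgM; [exact: cvg_cst|exact: cvg_iter_sign_step].
- exact: (integrable_cst_unitI 1).
- move=> n u _; have := iter_sign_step_norm n (p1 u).
  rewrite !ler_norml => /andP[? ?]; apply/andP; split; lra.
Qed.

(** Open right half-lines form a pi-system generating the Borel sets, and the sets with approximable
    indicator form a Dynkin class. *)
Lemma approximable_indic (S : set R) : measurable S -> approximable A \1_S.
Proof.
move=> mS; have : <<s @RGenOInfty.G R >> S.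
  suff : (@RGenOInfty.G R).-sigma.-measurable S by [].
  by rewrite -RGenOInfty.measurableE.
apply: (@dynkin_induction _ _ (@RGenOInfty.G R) (fun S => approximable A \1_S)).
- exact: RGenOInfty.measurableE.
- move=> _ _ [x ->] [y ->]; exists (Num.max x y).
  apply/seteqP; split => z /=; rewrite !in_itv/= !andbT gt_max.
    by case=> -> ->.
  by move=> /andP[].
- by rewrite indicT; exact: approxC.
- by move=> _ [x ->]; exact: approximable_ray.
- move=> B mB aB.
  suff -> : \1_(~` B) = (fun u => 1 + -1 * \1_B u) :> (R -> R).
    by apply: approx_lin => //; exact: approxC.
  apply/funext => u; rewrite !indicE in_setC.
  by case: (u \in B) => /=; lra.
- move=> F mF tF aF.
  (* By disjointness the partial sums only take the values 0 and 1, so they are dominated by 1, and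
     they are eventually constant at each point. *)
  have E n u : \sum_(k < n) \1_(F k) u = (`[< exists2 k, (k < n)%N & F k u >])%:R :> R.
    have [[k kn Fk]|nF] := pselect (exists2 k, (k < n)%N & F k u).
      rewrite asboolT; last by exists k.
      rewrite (bigD1 (Ordinal kn))//= indicE mem_set// big1 ?addr0// => i ik.
      rewrite indicE memNset// => Fi; move: ik; rewrite -val_eqE/= => /eqP; apply.
      by apply: tF => //; exists u.
    rewrite asboolF// big1// => i _; rewrite indicE memNset// => Fi.
    by apply: nF; exists i.
  apply: (@approximable_cvg R A _ (fun n u => \sum_(k < n) \1_(F k) u) (fun=> 1)) => //.
  + by apply: measurable_indic; exact: bigcup_measurable.
  + elim=> [|n IH].
      by under eq_fun do rewrite big_ord0; exact: approxC.
    under eq_fun do rewrite big_ord_recr/= -[\1_(F n) _]mul1r.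
    exact: approx_lin.
  + apply: nearW => u _; apply: cvg_near_cst.
    have [[k _ Fk]|nF] := pselect ((\bigcup_k F k) u).
      near=> n; rewrite E indicE asboolT ?mem_set//; first by exists k.
      by exists k => //; near: n; exact: nbhs_infty_gt.
    near=> n; rewrite E indicE asboolF ?memNset// => -[k _ Fk]; apply: nF.
    by exists k.
  + exact: (integrable_cst_unitI 1).
  + by move=> u _; rewrite indicE; case: (_ \in _); rewrite ?normr0 ?normr1.
  + by move=> n u _; rewrite E; case: asbool; rewrite ?normr0 ?normr1.
Unshelve. all: by end_near. Qed.

Import HBNNSimple.

(** Simple functions increase to [f] and are dominated by [f] itself, whose square is integrable. *)
Let approximable_ge0 f : measurable_fun setT f -> (forall u, 0 <= f u) ->
  mu.-integrable unitI (fun u => (f u ^+ 2)%:E) -> approximable A f.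
Proof.
move=> mf f0 if2.
have mEf : measurable_fun setT (EFin \o f) by exact/measurable_EFinP.
pose g := nnsfun_approx measurableT mEf.
have cg u : EFin \o g ^~ u @ \oo --> (f u)%:E.
  by apply: cvg_nnsfun_approx => // x _; rewrite lee_fin.
have cgr u : g ^~ u @ \oo --> f u by have /fine_cvgP[] := cg u.
have gf n u : 0 <= g n u <= f u.
  apply/andP; split; first exact: fun_ge0.
  rewrite -(cvg_lim _ (cgr u))//; apply: nondecreasing_cvgn_le.
    by move=> i j ij; apply/lefP/nd_nnsfun_approx.
  by apply/cvg_ex; exists (f u).
apply: (@approximable_cvg R A f g f) => //.
- move=> n.
  have fr : finite_set (range (g n)) by exact: fimfunP.
  have -> : (g n : R -> R) = fun x => \sum_(y <- fset_set (range (g n)))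
      (y * \1_(g n @^-1` [set y]) x).
    by apply/funext => x; rewrite fimfunE fsbig_finite.
  elim: (fset_set _ : seq R) => [|y r IH].
    by under eq_fun do rewrite big_nil; exact: approxC.
  under eq_fun do rewrite big_cons addrC.
  by apply: approx_lin => //; apply: approximable_indic; exact: measurable_funPTI.
- by apply: nearW => u _.
- by move=> u _; rewrite ger0_norm.
- by move=> n u _; have /andP[? ?] := gf n u; rewrite ger0_norm.
Qed.

Lemma approximable_L2 f : measurable_fun setT f ->
  mu.-integrable unitI (fun u => (f u ^+ 2)%:E) -> approximable A f.
Proof.
move=> mf if2.
have -> : f = fun u => f^\+ u + -1 * f^\- u.
  by rewrite -[LHS]funrposBneg; apply/funext => u; rewrite mulN1r.
have H g : measurable_fun setT g -> (forall u, 0 <= g u <= `|f u|) ->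
    approximable A g.
  move=> mg gf; apply: approximable_ge0 => // [u|]; first by case/andP: (gf u).
  apply: le_integrable if2; first exact: measurable_unitI.
    by apply/measurable_EFinP/measurable_funX/measurable_funTS.
  move=> u _ /=; rewrite lee_fin !normrX lerXn2r ?nnegrE//.
  by case/andP: (gf u) => ? ?; rewrite ger0_norm.
apply: approx_lin; apply: H.
- exact: measurable_funrpos.
- by move=> u; rewrite funrpos_ge0 /funrpos ge_max normr_ge0 ler_norm.
- exact: measurable_funrneg.
- by move=> u; rewrite funrneg_ge0 /funrneg ge_max normr_ge0 -normrN ler_norm.
Qed.

End Density.

(** * Orthogonal systems and a Parseval inequality *)

Section OrthogonalSeries.
Context {R : realType}.
Implicit Types (f g h : R -> R).

Local Notation mu := (@lebesgue_measure R).

Definition square_integrable f : Prop := measurable_fun setT f /\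
  mu.-integrable unitI (fun u => (f u ^+ 2)%:E).

(** The product is dominated by [f ^+ 2 + g ^+ 2]. *)
Lemma square_integrable_mul f g : square_integrable f -> square_integrable g ->
  mu.-integrable unitI (EFin \o (fun u => f u * g u)).
Proof.
move=> [mf if2] [mg ig2].
apply: (@le_integrable _ _ _ mu unitI measurable_unitI _
  (fun u => (f u ^+ 2)%:E + (g u ^+ 2)%:E)%E).
- apply/measurable_EFinP/measurable_funTS; exact: measurable_funM.
- move=> u _ /=; rewrite lee_fin [leRHS]ger0_norm ?addr_ge0 ?sqr_ge0//.
  rewrite ler_norml; have := sqr_ge0 (f u - g u); have := sqr_ge0 (f u + g u).
  by have := sqr_ge0 (f u); have := sqr_ge0 (g u) => *; apply/andP; split; nra.
- by apply: integrableD => //; exact: measurable_unitI.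
Qed.

Lemma square_integrable_lin f g (a : R) :
  square_integrable f -> square_integrable g ->
  square_integrable (fun u => f u + a * g u).
Proof.
move=> [mf if2] [mg ig2].
have mfg : measurable_fun setT (fun u => f u + a * g u).
  by apply: measurable_funD => //; exact: measurable_funM.
split => //; apply: (@le_integrable _ _ _ mu unitI measurable_unitI _
  (fun u => 2%:E * (f u ^+ 2)%:E + (2 * a ^+ 2)%:E * (g u ^+ 2)%:E)%E).
- by apply/measurable_EFinP/measurable_funTS/measurable_funX.
- move=> u _ /=; rewrite lee_fin ger0_norm ?sqr_ge0//.
  have -> : 2 * a ^+ 2 * g u ^+ 2 = 2 * (a * g u) ^+ 2 by ring.
  apply: le_trans (ler_norm _).
  by have := sqr_ge0 (f u - a * g u); nra.
- apply: integrableD; first exact: measurable_unitI.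
    by apply: integrableZl => //; exact: measurable_unitI.
  by apply: integrableZl => //; exact: measurable_unitI.
Qed.

Lemma innerC f g : inner f g = inner g f.
Proof. by apply: eq_Rintegral => u _; rewrite mulrC. Qed.

Lemma inner_lin f g h (a : R) :
  square_integrable f -> square_integrable g -> square_integrable h ->
  inner (fun u => f u + a * g u) h = inner f h + a * inner g h.
Proof.
move=> sf sg sh; rewrite /inner.
have ifh := square_integrable_mul sf sh; have igh := square_integrable_mul sg sh.
rewrite -RintegralZl//; last exact: measurable_unitI.
rewrite -RintegralD//; last 2 first.
- exact: measurable_unitI.
- rewrite (_ : EFin \o _ = (fun u => a%:E * (EFin \o (fun u => (g u * h u)%R)) u)%E);
    last by apply/funext => u /=; rewrite EFinM.
  by apply: integrableZl => //; exact: measurable_unitI.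
by apply: eq_Rintegral => u _; rewrite mulrDl mulrA.
Qed.

Lemma inner_lin_sqr f g (a : R) : square_integrable f -> square_integrable g ->
  inner (fun u => f u + a * g u) (fun u => f u + a * g u) =
  inner f f + 2 * a * inner f g + a ^+ 2 * inner g g.
Proof.
move=> sf sg; have sl := square_integrable_lin a sf sg.
rewrite inner_lin// (innerC f) (innerC g) !inner_lin// (innerC g f).
by ring.
Qed.

Lemma sqdist_inner f g : square_integrable f -> square_integrable g ->
  sqdist f g = (inner (fun u => f u - g u) (fun u => f u - g u))%:E.
Proof.
move=> sf sg; have := square_integrable_lin (-1) sf sg.
rewrite (_ : (fun u => f u + -1 * g u) = (fun u => f u - g u)); last first.
  by apply/funext => u; rewrite mulN1r.
move=> sl; rewrite /inner /Rintegral fineK.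
  by apply: eq_integral => u _; rewrite -expr2.
apply: integrable_fin_num; first exact: measurable_unitI.
exact: (square_integrable_mul sl sl).
Qed.

Variable b : nat -> R -> R.

Definition combination (a : nat -> R) n u : R := \sum_(k < n) a k * b k u.

Definition span_family : set (R -> R) :=
  [set p | exists a n, p = combination a n].

Hypothesis sb : forall k, square_integrable (b k).

Lemma square_integrable_combination a n : square_integrable (combination a n).
Proof.
elim: n => [|n IH].
  have := square_integrable_lin (-1) (sb 0) (sb 0).
  by congr square_integrable; apply/funext => u; rewrite /combination big_ord0; ring.
have := square_integrable_lin (a n) IH (sb n).
by congr square_integrable; apply/funext => u; rewrite /combination big_ord_recr.
Qed.

(** Padding with zero coefficients lets two combinations share a common length. *)
Lemma combination_trunc a n m : (n <= m)%N ->
  combination a n = combination (fun k => if (k < n)%N then a k else 0) m.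
Proof.
move=> nm; apply/funext => u; rewrite /combination.
rewrite (big_ord_widen _ (fun k => a k * b k u) nm) big_mkcond/=.
by apply: eq_bigr => k _; case: ifP; rewrite ?mul0r.
Qed.

Lemma span_family_lin p q c : span_family p -> span_family q ->
  span_family (fun u => p u + c * q u).
Proof.
move=> [a [n ->]] [a' [n' ->]].
rewrite (combination_trunc a (leq_maxl n n')) (combination_trunc a' (leq_maxr n n')).
exists (fun k => (if (k < n)%N then a k else 0) +
  c * (if (k < n')%N then a' k else 0)), (maxn n n'); apply/funext => u.
rewrite /combination mulr_sumr -big_split/=; apply: eq_bigr => k _; ring.
Qed.

Lemma span_family_mem k : span_family (b k).
Proof.
exists (fun i => (i == k)%:R), k.+1; apply/funext => u.
rewrite /combination (bigD1 ord_max)//= eqxx mul1r big1 ?addr0// => i.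
by rewrite -val_eqE/= => /negbTE ->; rewrite mul0r.
Qed.

Lemma span_family_zero : span_family (fun=> 0).
Proof.
by exists (fun=> 0), 0%N; apply/funext => u; rewrite /combination big_ord0.
Qed.

Lemma span_family_scale c p : span_family p -> span_family (fun u => c * p u).
Proof.
move=> sp; have := span_family_lin c span_family_zero sp.
by congr span_family; apply/funext => u; rewrite add0r.
Qed.

Lemma span_family_sum (F : nat -> R -> R) n : (forall k, span_family (F k)) ->
  span_family (fun u => \sum_(k < n) F k u).
Proof.
move=> sF; elim: n => [|n IH].
  by under eq_fun do rewrite big_ord0; exact: span_family_zero.
have := span_family_lin 1 IH (sF n).
by congr span_family; apply/funext => u; rewrite big_ord_recr mul1r.
Qed.

(** By bilinearity, stability under products only has to be checked on pairs of basis elements,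
    where product-to-sum formulas apply. *)
Lemma span_family_mul p q : (forall i j, span_family (fun u => b i u * b j u)) ->
  span_family p -> span_family q -> span_family (fun u => p u * q u).
Proof.
move=> sbb [a [n ->]] [a' [n' ->]].
have := @span_family_sum
  (fun i u => \sum_(j < n') (a i * a' j) * (b i u * b j u)) n _.
rewrite (_ : (fun u => \sum_(k < n) _) =
    (fun u => combination a n u * combination a' n' u)); last first.
  apply/funext => u; rewrite /combination mulr_suml; apply: eq_bigr => i _.
  by rewrite mulr_sumr; apply: eq_bigr => j _; ring.
apply => i; apply: (@span_family_sum (fun j u => (a i * a' j) * (b i u * b j u))).
by move=> j; exact: span_family_scale.
Qed.

Hypothesis b_orth : forall i j, i != j -> inner (b i) (b j) = 0.
Hypothesis b_norm : forall i, 2^-1 <= inner (b i) (b i).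

Lemma inner_combination_orth a n k : (n <= k)%N -> inner (combination a n) (b k) = 0.
Proof.
elim: n => [|n IH] nk.
  rewrite /inner /Rintegral; under eq_integral do rewrite /combination big_ord0 mul0r.
  by rewrite integral0.
rewrite (_ : combination a n.+1 = fun u => combination a n u + a n * b n u); last first.
  by apply/funext => u; rewrite /combination big_ord_recr.
rewrite inner_lin//; last exact: square_integrable_combination.
by rewrite IH ?(ltnW nk)// b_orth ?mulr0 ?addr0// ltn_eqF.
Qed.

Lemma bessel_defect f a n : square_integrable f ->
  inner f f - \sum_(k < n) 2 * inner f (b k) ^+ 2 <=
  inner (fun u => f u - combination a n u) (fun u => f u - combination a n u).
Proof.
move=> sf; elim: n => [|n IH].
  rewrite big_ord0 subr0 le_eqVlt; apply/orP; left; apply/eqP.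
  by congr inner; apply/funext => u; rewrite /combination big_ord0 subr0.
set r := (fun u => f u - combination a n u) in IH *.
have sr : square_integrable r.
  have := square_integrable_lin (-1) sf (square_integrable_combination a n).
  by congr square_integrable; apply/funext => u; rewrite /r mulN1r.
rewrite (_ : (fun u => f u - combination a n.+1 u) = fun u => r u + - a n * b n u); last first.
  by apply/funext => u; rewrite /r /combination big_ord_recr/=; ring.
rewrite inner_lin_sqr// big_ord_recr/=.
have -> : inner r (b n) = inner f (b n).
  rewrite (_ : r = fun u => f u + -1 * combination a n u); last first.
    by apply/funext => u; rewrite /r mulN1r.
  rewrite inner_lin// ?inner_combination_orth ?mulr0 ?addr0//.
  exact: square_integrable_combination.
set c := inner f (b n); have := b_norm n; set N := inner (b n) (b n) => N2.
(* With [a] for [a n]: [a ^+ 2 * N - 2 * a * c + 2 * c ^+ 2] equals [(a - 2 * c) ^+ 2 / 2 + a ^+ 2 *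
   (N - 2^-1)]. *)
have := sqr_ge0 (a n - 2 * c); have := sqr_ge0 (a n); nra.
Qed.

Lemma parseval_le f (e : R) : square_integrable f ->
  approximable span_family f -> 0 < e ->
  exists N, inner f f <= e + \sum_(k < N) 2 * inner f (b k) ^+ 2.
Proof.
move=> sf [_ af] e0; have [p [a [n ->]]] := af e e0.
rewrite sqdist_inner//; last exact: square_integrable_combination.
by rewrite lee_fin => fa; exists n; have := bessel_defect a n sf; lra.
Qed.

End OrthogonalSeries.

(** * Integrals of trigonometric functions and exponentials *)

Section TrigonometricIntegrals.
Context {R : realType}.
Implicit Types (w u : R).

Local Notation mu := (@lebesgue_measure R).

(** The degenerate case [a = b] is included for time integrals up to [t = 0]. *)
Lemma Rintegral_derive (F f : R -> R) (a b : R) : a <= b ->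
  (forall x, is_derive x (1 : R) F (f x)) -> continuous f ->
  \int[mu]_(x in `[a, b]) f x = F b - F a.
Proof.
rewrite le_eqVlt => /predU1P[<-|ab] dF cf.
  by rewrite set_itv1 Rintegral_set1 subrr.
have cF x : {for x, continuous F}.
  by apply: differentiable_continuous; apply/derivable1_diffP; case: (dF x).
rewrite /Rintegral (@continuous_FTC2 _ f F)//.
- exact: continuous_subspaceT.
- split; first by move=> x _; case: (dF x).
    by apply: cvg_at_right_filter; exact: cF.
  by apply: cvg_at_left_filter; exact: cF.
- by move=> x _; rewrite derive1E; case: (dF x).
Qed.

Lemma is_derive_sinM w u :
  is_derive u (1 : R) (fun u => sin (w * u)) (w * cos (w * u)).
Proof.
have d : is_derive u (1 : R) (fun u => w * u) w.
  by have := is_deriveZ w (is_derive_id u 1); rewrite /GRing.scale/= mulr1.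
by rewrite [w * _]mulrC; exact: (is_derive1_comp (is_derive_sin (w * u)) d).
Qed.

Lemma is_derive_cosM w u :
  is_derive u (1 : R) (fun u => cos (w * u)) (- (w * sin (w * u))).
Proof.
have d : is_derive u (1 : R) (fun u => w * u) w.
  by have := is_deriveZ w (is_derive_id u 1); rewrite /GRing.scale/= mulr1.
rewrite [w * _]mulrC -mulNr.
exact: (is_derive1_comp (is_derive_cos (w * u)) d).
Qed.

Lemma is_derive_expRM w t u :
  is_derive u (1 : R) (fun s => expR (w * (s - t))) (w * expR (w * (u - t))).
Proof.
have d : is_derive u (1 : R) (fun s => w * (s - t)) w.
  have := is_deriveZ w (is_deriveB (is_derive_id u 1) (is_derive_cst t u 1)).
  by rewrite /GRing.scale/= subr0 mulr1.
have := @is_derive1_comp R expR (fun s => w * (s - t)) u _ _ (is_derive_expR _) d.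
by rewrite mulrC.
Qed.

Lemma continuous_mull w : continuous (fun u => w * u).
Proof. by move=> u; apply: cvgM; [exact: cvg_cst|exact: cvg_id]. Qed.

Lemma continuous_cosM w : continuous (fun u => cos (w * u)).
Proof.
move=> u; apply: continuous_comp; [exact: continuous_mull|exact: continuous_cos].
Qed.

Lemma continuous_sinM w : continuous (fun u => sin (w * u)).
Proof.
move=> u; apply: continuous_comp; [exact: continuous_mull|exact: continuous_sin].
Qed.

Lemma continuous_expRM w t : continuous (fun s => expR (w * (s - t))).
Proof.
move=> u; apply: (continuous_comp (f := fun s => w * (s - t)) (g := expR)).
  by apply: cvgM; [exact: cvg_cst|apply: cvgB; [exact: cvg_id|exact: cvg_cst]].
exact: continuous_expR.
Qed.

Lemma Rintegral_cosM w : w != 0 ->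
  \int[mu]_(u in unitI) cos (w * u) = sin w / w.
Proof.
move=> w0; have D u : is_derive u (1 : R) (fun u => w^-1 * sin (w * u)) (cos (w * u)).
  have := is_deriveZ w^-1 (is_derive_sinM w u).
  by rewrite /GRing.scale/= mulrA mulVf// mul1r.
rewrite (Rintegral_derive ler01 D (@continuous_cosM w)).
by rewrite mulr1 mulr0 sin0 mulr0 subr0 mulrC.
Qed.

Lemma Rintegral_sinM w : w != 0 ->
  \int[mu]_(u in unitI) sin (w * u) = (1 - cos w) / w.
Proof.
move=> w0; have D u : is_derive u (1 : R) (fun u => - w^-1 * cos (w * u)) (sin (w * u)).
  have := is_deriveZ (- w^-1) (is_derive_cosM w u).
  by rewrite /GRing.scale/= mulrNN mulrA mulVf// mul1r.
rewrite (Rintegral_derive ler01 D (@continuous_sinM w)).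
by rewrite mulr1 mulr0 cos0; ring.
Qed.

(** The exact value is [(1 - expR (- (w * t))) / w]. The gain [w^-1], uniform in [t], is the source
    of all decay in the frequency. *)
Lemma Rintegral_expRM w t : 0 < w -> 0 <= t ->
  \int[mu]_(s in timeI t) expR (w * (s - t)) <= w^-1.
Proof.
move=> w0 t0.
have D s : is_derive s (1 : R) (fun s => w^-1 * expR (w * (s - t)))
    (expR (w * (s - t))).
  have := is_deriveZ w^-1 (is_derive_expRM w t s).
  by rewrite /GRing.scale/= mulrA mulVf ?gt_eqF// mul1r.
rewrite (Rintegral_derive t0 D (@continuous_expRM w t)).
rewrite subrr mulr0 expR0 mulr1 gerBl mulr_ge0 ?invr_ge0 ?(ltW w0)//.
Qed.

Lemma square_integrable_bounded (f : R -> R) : continuous f ->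
  (forall u, `|f u| <= 1) -> square_integrable f.
Proof.
move=> cf f1; have mf := continuous_measurable_fun cf.
split=> //; apply: le_integrable (integrable_cst_unitI 1).
- exact: measurable_unitI.
- by apply/measurable_EFinP/measurable_funX/measurable_funTS.
- move=> u _ /=; rewrite lee_fin expr1n normr1 normrX.
  by rewrite expr_le1 ?normr_ge0.
Qed.

Lemma cosMcos (x y : R) : cos x * cos y = (cos (x - y) + cos (x + y)) / 2.
Proof. by rewrite cosB cosD; field. Qed.

Lemma sinMsin (x y : R) : sin x * sin y = (cos (x - y) - cos (x + y)) / 2.
Proof. by rewrite cosB cosD; field. Qed.

Lemma sinMcos (x y : R) : sin x * cos y = (sin (x - y) + sin (x + y)) / 2.
Proof. by rewrite sinB sinD; field. Qed.

Lemma sin_intpi (z : int) : sin (z%:~R * pi) = 0 :> R.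
Proof.
suff H n : sin (n%:R * pi) = 0 :> R.
  by case: (intP z) => [|n|n]; rewrite ?mul0r ?sin0// ?mulrNz ?mulNr ?sinN -?pmulrn ?H ?oppr0.
by have := alternatingn (@sinDpi R) n 0; rewrite add0r sin0 mulr0 mulr_natl.
Qed.

Lemma cos_int2pi (z : int) : cos (2 * (z%:~R * pi)) = 1 :> R.
Proof. by rewrite mulr_natl cos_mulr2n cos2sin2 sin_intpi expr0n subr0; lra. Qed.

Lemma sin_int2pi (z : int) : sin (2 * (z%:~R * pi)) = 0 :> R.
Proof. by rewrite mulr_natl sin_mulr2n sin_intpi mulr0 mul0rn. Qed.

(** Frequencies are integers rather than naturals because product-to-sum formulas produce
    differences of indices. *)
Lemma Rintegral_cos_intpi (z : int) :
  \int[mu]_(u in unitI) cos (z%:~R * pi * u) = (z == 0)%:R.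
Proof.
have [->|z0] := eqVneq z 0.
  rewrite mul0r; under eq_Rintegral do rewrite mul0r cos0.
  rewrite Rintegral_cst; last exact: measurable_unitI.
  by rewrite /= /unitI lebesgue_measure_itv/= lte_fin ltr01 -EFinB subr0 mul1r.
rewrite Rintegral_cosM ?sin_intpi ?mul0r//.
by apply: mulf_neq0; [rewrite intr_eq0|exact: lt0r_neq0 (pi_gt0 R)].
Qed.

Lemma Rintegral_sin_int2pi (z : int) :
  \int[mu]_(u in unitI) sin (2 * (z%:~R * pi) * u) = 0.
Proof.
have [->|z0] := eqVneq z 0.
  rewrite mul0r mulr0; under eq_Rintegral do rewrite mul0r sin0.
  by rewrite Rintegral_cst ?mul0r//; exact: measurable_unitI.
rewrite Rintegral_sinM ?cos_int2pi ?subrr ?mul0r//.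
by rewrite mulf_neq0 ?mulf_neq0 ?intr_eq0 ?pnatr_eq0 ?(lt0r_neq0 (pi_gt0 R)).
Qed.

End TrigonometricIntegrals.

(** * The cosine and Fourier systems: orthogonality and completeness *)

Section Bases.
Context {R : realType}.

Local Notation mu := (@lebesgue_measure R).

Definition cosine_basis (k : nat) (u : R) : R := cos (k%:R * pi * u).

(* 1, sin (2 pi u), cos (2 pi u), sin (4 pi u), cos (4 pi u), ... *)
Definition fourier_basis (k : nat) (u : R) : R :=
  if odd k then sin (2 * ((uphalf k)%:R * pi) * u)
  else cos (2 * (k./2%:R * pi) * u).

Lemma cosine_basis_square_integrable k : square_integrable (cosine_basis k).
Proof.
apply: square_integrable_bounded; first exact: continuous_cosM.
by move=> u; exact: cos_max.
Qed.

Lemma fourier_basis_square_integrable k : square_integrable (fourier_basis k).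
Proof.
rewrite /fourier_basis; case: (odd k); apply: square_integrable_bounded.
- exact: continuous_sinM.
- by move=> u; exact: sin_max.
- exact: continuous_cosM.
- by move=> u; exact: cos_max.
Qed.

Lemma span_cosine (z : int) :
  span_family cosine_basis (fun u => cos (z%:~R * pi * u)).
Proof.
suff -> : (fun u : R => cos (z%:~R * pi * u)) = cosine_basis `|z|%N.
  exact: span_family_mem.
apply/funext => u; rewrite /cosine_basis natr_absz.
have [z0|z0] := leP 0 z; first by rewrite ger0_norm.
by rewrite ler0_norm ?(ltW z0)// mulrNz !mulNr cosN.
Qed.

Lemma span_fourier_cos (z : int) :
  span_family fourier_basis (fun u => cos (2 * (z%:~R * pi) * u)).
Proof.
suff -> : (fun u : R => cos (2 * (z%:~R * pi) * u)) = fourier_basis `|z|.*2%N.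
  exact: span_family_mem.
apply/funext => u; rewrite /fourier_basis odd_double doubleK natr_absz.
have [z0|z0] := leP 0 z; first by rewrite ger0_norm.
by rewrite ler0_norm ?(ltW z0)// mulrNz mulNr mulrN mulNr cosN.
Qed.

Lemma span_fourier_sin (z : int) :
  span_family fourier_basis (fun u => sin (2 * (z%:~R * pi) * u)).
Proof.
suff H (n : nat) : span_family fourier_basis (fun u => sin (2 * (n%:R * pi) * u)).
  have [z0|z0] := leP 0 z.
    by have := H `|z|%N; rewrite natr_absz ger0_norm.
  have := span_family_scale (-1) (H `|z|%N).
  rewrite natr_absz ler0_norm ?(ltW z0)//; congr span_family.
  by apply/funext => u; rewrite mulN1r mulrNz mulNr mulrN mulNr sinN opprK.
(* The basis has no sine of frequency 0: index [n.*2.+1] carries frequency [n.+1]. *)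
case: n => [|n].
  rewrite (_ : (fun u => _) = fun=> 0); first exact: span_family_zero.
  by apply/funext => u; rewrite mul0r mulr0 mul0r sin0.
have := @span_family_mem _ fourier_basis n.*2.+1.
by congr span_family; apply/funext => u; rewrite /fourier_basis/= odd_double/= doubleK.
Qed.

Lemma cosine_mul i j (u : R) : cosine_basis i u * cosine_basis j u =
  2^-1 * cos ((i%:Z - j%:Z)%:~R * pi * u) + 2^-1 * cos ((i%:Z + j%:Z)%:~R * pi * u).
Proof.
rewrite cosMcos mulrDl ![_ / 2]mulrC; congr (_ * cos _ + _ * cos _).
  by rewrite rmorphB/= -!pmulrn; ring.
by rewrite rmorphD/= -!pmulrn; ring.
Qed.

Lemma cosine_algebra : function_algebra (span_family cosine_basis).
Proof.
split.
- by move=> _ [a [n ->]]; have [] := square_integrable_combination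
    cosine_basis_square_integrable a n.
- by move=> p q b; exact: span_family_lin.
- move=> p q; apply: span_family_mul => i j.
  have := span_family_lin 2^-1
    (span_family_scale 2^-1 (span_cosine (i%:Z - j%:Z))) (span_cosine (i%:Z + j%:Z)).
  by congr span_family; apply/funext => u; rewrite cosine_mul.
- have := span_cosine 0; congr span_family; apply/funext => u.
  by rewrite mul0r mul0r cos0.
Qed.

Lemma inner_product_to_sum (f g p q : R -> R) (a b : R) :
  square_integrable p -> square_integrable q ->
  (forall u, f u * g u = a * p u + b * q u) ->
  inner f g = a * \int[mu]_(u in unitI) p u + b * \int[mu]_(u in unitI) q u.
Proof.
move=> sp sq fg.
have s1 : square_integrable (fun=> 1 : R).
  by apply: square_integrable_bounded; [exact: cst_continuous|move=> u; rewrite normr1].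
have E h : \int[mu]_(u in unitI) h u = inner h (fun=> 1).
  by apply: eq_Rintegral => u _; rewrite mulr1.
(* Integrals become inner products with 1, and the leading 0 gives the shape to which [inner_lin]
   applies twice. *)
rewrite [LHS](_ : _ = inner (fun u => (0 + a * p u) + b * q u) (fun=> 1)); last first.
  by apply: eq_Rintegral => u _; rewrite fg mulr1 add0r.
have s0 : square_integrable (fun=> 0 : R).
  by apply: square_integrable_bounded; [exact: cst_continuous|move=> u; rewrite normr0].
rewrite !inner_lin//; last exact: square_integrable_lin.
rewrite -!E Rintegral_cst ?mul0r ?add0r//; exact: measurable_unitI.
Qed.

Lemma square_integrable_cosM w : square_integrable (fun u : R => cos (w * u)).
Proof.
apply: square_integrable_bounded; first exact: continuous_cosM.
by move=> u; exact: cos_max.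
Qed.

Lemma square_integrable_sinM w : square_integrable (fun u : R => sin (w * u)).
Proof.
apply: square_integrable_bounded; first exact: continuous_sinM.
by move=> u; exact: sin_max.
Qed.

(** The second term is nonzero only for [i = j = 0], where the squared norm is 1 instead of
    [2^-1]. *)
Lemma inner_cosine i j : inner (cosine_basis i) (cosine_basis j) =
  2^-1 * (i%:Z - j%:Z == 0)%:R + 2^-1 * (i%:Z + j%:Z == 0)%:R.
Proof.
rewrite (inner_product_to_sum _ _ (cosine_mul i j));
  [|exact: square_integrable_cosM..].
by rewrite !Rintegral_cos_intpi.
Qed.

Lemma cosine_orth i j : i != j -> inner (cosine_basis i) (cosine_basis j) = 0.
Proof.
move=> ij; rewrite inner_cosine subr_eq0 eqz_nat (negbTE ij) mulr0 add0r.
suff -> : (i%:Z + j%:Z == 0) = false by rewrite mulr0.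
by apply/negbTE; move: ij; lia.
Qed.

Lemma cosine_norm i : 2^-1 <= inner (cosine_basis i) (cosine_basis i).
Proof.
by rewrite inner_cosine subrr eqxx mulr1 lerDl mulr_ge0 ?invr_ge0.
Qed.

Lemma fourier_even m (u : R) :
  fourier_basis m.*2 u = cos (2 * (m%:Z%:~R * pi) * u).
Proof. by rewrite /fourier_basis odd_double doubleK. Qed.

Lemma fourier_odd m (u : R) :
  fourier_basis m.*2.+1 u = sin (2 * (m.+1%:Z%:~R * pi) * u).
Proof. by rewrite /fourier_basis/= odd_double/= doubleK. Qed.

Lemma nat_parity_ind (P : nat -> Prop) : (forall m, P m.*2) -> (forall m, P m.*2.+1) ->
  forall k, P k.
Proof.
move=> P0 P1 k; rewrite -(odd_double_half k).
by case: (odd k); [exact: P1|exact: P0].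
Qed.

Lemma cos_cos_int (m n : int) (u : R) :
  cos (2 * (m%:~R * pi) * u) * cos (2 * (n%:~R * pi) * u) =
  2^-1 * cos (2 * ((m - n)%:~R * pi) * u) + 2^-1 * cos (2 * ((m + n)%:~R * pi) * u).
Proof.
rewrite cosMcos mulrDl ![_ / 2]mulrC; congr (_ * cos _ + _ * cos _).
  by rewrite rmorphB/=; ring.
by rewrite rmorphD/=; ring.
Qed.

Lemma sin_sin_int (m n : int) (u : R) :
  sin (2 * (m%:~R * pi) * u) * sin (2 * (n%:~R * pi) * u) =
  2^-1 * cos (2 * ((m - n)%:~R * pi) * u) + - 2^-1 * cos (2 * ((m + n)%:~R * pi) * u).
Proof.
rewrite sinMsin mulrDl ![_ / 2]mulrC mulrN -mulNr; congr (_ * cos _ + _ * cos _).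
  by rewrite rmorphB/=; ring.
by rewrite rmorphD/=; ring.
Qed.

Lemma sin_cos_int (m n : int) (u : R) :
  sin (2 * (m%:~R * pi) * u) * cos (2 * (n%:~R * pi) * u) =
  2^-1 * sin (2 * ((m - n)%:~R * pi) * u) + 2^-1 * sin (2 * ((m + n)%:~R * pi) * u).
Proof.
rewrite sinMcos mulrDl ![_ / 2]mulrC; congr (_ * sin _ + _ * sin _).
  by rewrite rmorphB/=; ring.
by rewrite rmorphD/=; ring.
Qed.

Lemma Rintegral_cos_int2pi (z : int) :
  \int[mu]_(u in unitI) cos (2 * (z%:~R * pi) * u) = (z == 0)%:R.
Proof.
rewrite -(_ : (2 * z == 0) = (z == 0)); last by lia.
rewrite -Rintegral_cos_intpi; apply: eq_Rintegral => u _; congr cos.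
by rewrite rmorphM/=; ring.
Qed.

Lemma inner_fourier_ee m n : inner (fourier_basis m.*2) (fourier_basis n.*2) =
  2^-1 * (m%:Z - n%:Z == 0)%:R + 2^-1 * (m%:Z + n%:Z == 0)%:R.
Proof.
rewrite -!Rintegral_cos_int2pi.
apply: inner_product_to_sum; try exact: square_integrable_cosM.
by move=> u; rewrite !fourier_even cos_cos_int.
Qed.

Lemma inner_fourier_oo m n :
  inner (fourier_basis m.*2.+1) (fourier_basis n.*2.+1) =
  2^-1 * (m.+1%:Z - n.+1%:Z == 0)%:R + - 2^-1 * (m.+1%:Z + n.+1%:Z == 0)%:R.
Proof.
rewrite -!Rintegral_cos_int2pi.
apply: inner_product_to_sum; try exact: square_integrable_cosM.
by move=> u; rewrite !fourier_odd sin_sin_int.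
Qed.

Lemma inner_fourier_oe m n :
  inner (fourier_basis m.*2.+1) (fourier_basis n.*2) = 0.
Proof.
have E u : fourier_basis m.*2.+1 u * fourier_basis n.*2 u = _ :=
  etrans (congr2 *%R (fourier_odd m u) (fourier_even n u))
         (sin_cos_int m.+1%:Z n%:Z u).
rewrite (inner_product_to_sum _ _ E); [|exact: square_integrable_sinM..].
by rewrite !Rintegral_sin_int2pi !mulr0 addr0.
Qed.

Lemma fourier_orth i j : i != j -> inner (fourier_basis i) (fourier_basis j) = 0.
Proof.
elim/nat_parity_ind: i => m; elim/nat_parity_ind: j => n ij.
- rewrite inner_fourier_ee.
  have -> : (m%:Z - n%:Z == 0) = false by apply/negbTE; move: ij; lia.
  have -> : (m%:Z + n%:Z == 0) = false by apply/negbTE; move: ij; lia.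
  by rewrite !mulr0 addr0.
- by rewrite innerC inner_fourier_oe.
- by rewrite inner_fourier_oe.
- rewrite inner_fourier_oo.
  have -> : (m.+1%:Z - n.+1%:Z == 0) = false by apply/negbTE; move: ij; lia.
  have -> : (m.+1%:Z + n.+1%:Z == 0) = false by apply/negbTE; move: ij; lia.
  by rewrite !mulr0 addr0.
Qed.

Lemma fourier_norm i : 2^-1 <= inner (fourier_basis i) (fourier_basis i).
Proof.
elim/nat_parity_ind: i => m.
  by rewrite inner_fourier_ee subrr eqxx mulr1 lerDl mulr_ge0 ?invr_ge0.
rewrite inner_fourier_oo subrr eqxx mulr1.
have -> : (m.+1%:Z + m.+1%:Z == 0) = false by apply/negbTE; lia.
by rewrite mulr0 addr0.
Qed.

Lemma fourier_algebra : function_algebra (span_family fourier_basis).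
Proof.
have lin2 (f g : R -> R) (a b : R) : span_family fourier_basis f ->
    span_family fourier_basis g ->
    span_family fourier_basis (fun u => a * f u + b * g u).
  by move=> sf sg; apply: span_family_lin => //; exact: span_family_scale.
split.
- by move=> _ [a [n ->]]; have [] := square_integrable_combination
    fourier_basis_square_integrable a n.
- by move=> p q b; exact: span_family_lin.
- move=> p q; apply: span_family_mul => i j.
  elim/nat_parity_ind: i => m; elim/nat_parity_ind: j => n.
  + under eq_fun do rewrite !fourier_even cos_cos_int.
    by apply: lin2; exact: span_fourier_cos.
  + under eq_fun do rewrite fourier_even fourier_odd mulrC sin_cos_int.
    by apply: lin2; exact: span_fourier_sin.
  + under eq_fun do rewrite fourier_even fourier_odd sin_cos_int.
    by apply: lin2; exact: span_fourier_sin.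
  + under eq_fun do rewrite !fourier_odd sin_sin_int.
    by apply: lin2; exact: span_fourier_cos.
- have := span_fourier_cos 0; congr span_family; apply/funext => u.
  by rewrite mul0r mulr0 mul0r cos0.
Qed.

(** The witness is [(cos (pi * u) - cos (pi * c)) / 2], the cosine being strictly decreasing on
    [0, pi]; halving keeps it within [-1,1]. The constant is written as a cosine of frequency 0. *)
Lemma cosine_separation (c : R) : 0 < c < 1 ->
  exists2 p, span_family cosine_basis p & (forall u, `|p u| <= 1) /\
  (forall u, 0 < u < 1 -> (u < c -> 0 < p u) /\ (c < u -> p u < 0)).
Proof.
move=> /andP[c0 c1].
exists (fun u => 2^-1 * cos (1%:~R * pi * u) + - (cos (pi * c) / 2) * cos (0%:~R * pi * u)).
  by apply: span_family_lin; [apply: span_family_scale|]; exact: span_cosine.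
have E (u : R) : 2^-1 * cos (1%:~R * pi * u) + - (cos (pi * c) / 2) * cos (0%:~R * pi * u) =
    (cos (pi * u) - cos (pi * c)) / 2.
  by rewrite mul0r mul0r cos0 mul1r; ring.
split=> [u|u /andP[u0 u1]]; rewrite E.
  have := cos_max (pi * u); have := cos_max (pi * c); rewrite !ler_norml.
  by move=> /andP[? ?] /andP[? ?]; apply/andP; split; lra.
have P0 := pi_gt0 R.
have I (x : R) : 0 < x < 1 -> pi * x \in `[0, pi].
  move=> /andP[x0 x1]; rewrite in_itv/= mulr_ge0 ?(ltW x0) ?(ltW P0)//=.
  by rewrite ler_piMr ?ltW.
have Iu : pi * u \in `[0, pi] by apply: I; rewrite u0.
have Ic : pi * c \in `[0, pi] by apply: I; rewrite c0.
split=> uc.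
  have : cos (pi * c) < cos (pi * u) by rewrite ltr_cos// ltr_pM2l.
  by move=> ?; lra.
have : cos (pi * u) < cos (pi * c) by rewrite ltr_cos// ltr_pM2l.
by move=> ?; lra.
Qed.

(* [sin (pi u) sin (pi (c - u))] has the sign of [c - u] on (0, 1) and expands
   into 1, cos (2 pi u), sin (2 pi u). *)
Lemma fourier_separation (c : R) : 0 < c < 1 ->
  exists2 p, span_family fourier_basis p & (forall u, `|p u| <= 1) /\
  (forall u, 0 < u < 1 -> (u < c -> 0 < p u) /\ (c < u -> p u < 0)).
Proof.
move=> /andP[c0 c1]; exists (fun u => sin (pi * u) * sin (pi * (c - u))).
  rewrite (_ : (fun u => _) = fun u =>
    cos (pi * c) / 2 * cos (2 * (1%:~R * pi) * u) +
    (sin (pi * c) / 2 * sin (2 * (1%:~R * pi) * u) +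
    - (cos (pi * c) / 2) * cos (2 * (0%:~R * pi) * u))).
    have := span_family_lin 1 (span_family_scale (cos (pi * c) / 2) (span_fourier_cos 1))
      (span_family_lin (- (cos (pi * c) / 2))
        (span_family_scale (sin (pi * c) / 2) (span_fourier_sin 1)) (span_fourier_cos 0)).
    by congr span_family; apply/funext => u; rewrite mul1r.
  apply/funext => u; rewrite sinMsin.
  have -> : pi * u - pi * (c - u) = 2 * pi * u - pi * c by ring.
  have -> : pi * u + pi * (c - u) = pi * c by ring.
  by rewrite cosB mul0r mulr0 mul0r cos0 mul1r; ring.
split=> [u|u /andP[u0 u1]].
  by rewrite normrM mulr_ile1 ?normr_ge0 ?sin_max.
have P0 := pi_gt0 R.
have su : 0 < sin (pi * u) by rewrite sin_gt0_pi// mulr_gt0//= gtr_pMr.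
split=> uc.
  rewrite mulr_gt0// sin_gt0_pi// mulr_gt0 ?subr_gt0//= gtr_pMr//; lra.
(* For [c < u] the second factor is [- sin (pi * (u - c))]. *)
rewrite pmulr_rlt0// -oppr_gt0 -sinN -mulrN opprB.
rewrite sin_gt0_pi// mulr_gt0 ?subr_gt0//= gtr_pMr//; lra.
Qed.

Lemma parseval_cosine f (e : R) : square_integrable f -> 0 < e ->
  exists N, inner f f <= e + \sum_(k < N) 2 * inner f (cosine_basis k) ^+ 2.
Proof.
move=> sf e0; apply: parseval_le => //.
- exact: cosine_basis_square_integrable.
- exact: cosine_orth.
- exact: cosine_norm.
- case: sf => mf if2.
  exact: (approximable_L2 cosine_algebra cosine_separation mf if2).
Qed.

Lemma parseval_fourier f (e : R) : square_integrable f -> 0 < e ->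
  exists N, inner f f <= e + \sum_(k < N) 2 * inner f (fourier_basis k) ^+ 2.
Proof.
move=> sf e0; apply: parseval_le => //.
- exact: fourier_basis_square_integrable.
- exact: fourier_orth.
- exact: fourier_norm.
- case: sf => mf if2.
  exact: (approximable_L2 fourier_algebra fourier_separation mf if2).
Qed.

End Bases.

(** * Bounds for integrals without measurability of the integrand *)

Section NonMeasurableBounds.
Context d (T : measurableType d) (R : realType).
Variable mu : {measure set T -> \bar R}.

(* The integral of a nonnegative function is a supremum over simple functions
   below it, hence monotone without any measurability assumption. *)
Lemma ge0_le_integral_nonmeasurable (D : set T) (f g : T -> \bar R) :
  (forall x, D x -> 0 <= f x)%E -> (forall x, D x -> f x <= g x)%E ->
  (\int[mu]_(x in D) f x <= \int[mu]_(x in D) g x)%E.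
Proof.
move=> f0 fg; have g0 x : D x -> (0 <= g x)%E.
  by move=> Dx; exact: le_trans (f0 _ Dx) (fg _ Dx).
rewrite !ge0_integralE//; apply: ereal_sup_le => _ [h /= hf <-].
exists h => //= x; apply: le_trans (hf x) _.
rewrite /patch; case: ifPn => // xD; apply: fg; exact: set_mem.
Qed.

(** The positive and negative parts of [f] have integrals between 0 and that of [g], hence so does
    the absolute value of their difference. It is applied to time integrals of the traces
    [cont_rep (rho s)], whose measurability in [s] is thus never discussed. *)
Lemma normr_Rintegral_le (D : set T) (f g : T -> R) :
  mu.-integrable D (EFin \o g) -> (forall x, D x -> `|f x| <= g x) ->
  measurable D ->
  `|\int[mu]_(x in D) f x| <= \int[mu]_(x in D) g x.
Proof.
move=> ig fg mD; have fing := integrable_fin_num mD ig.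
rewrite /Rintegral -lee_fin fineK// integralE.
set A := (\int[mu]_(x in D) _)%E; set B := (\int[mu]_(x in D) _)%E.
have A0 : (0 <= A)%E by apply: integral_ge0 => x _; rewrite funepos_ge0.
have B0 : (0 <= B)%E by apply: integral_ge0 => x _; rewrite funeneg_ge0.
have AG : (A <= \int[mu]_(x in D) (g x)%:E)%E.
  apply: ge0_le_integral_nonmeasurable => x Dx; first by rewrite funepos_ge0.
  rewrite funeposE -EFin_max lee_fin ge_max (le_trans (ler_norm _) (fg _ Dx)).
  exact: le_trans (normr_ge0 _) (fg _ Dx).
have BG : (B <= \int[mu]_(x in D) (g x)%:E)%E.
  apply: ge0_le_integral_nonmeasurable => x Dx; first by rewrite funeneg_ge0.
  rewrite funenegE -EFinN -EFin_max lee_fin ge_max.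
  rewrite (le_trans (ler_norm (- f x))) ?normrN ?fg//=.
  exact: le_trans (normr_ge0 _) (fg _ Dx).
move: A0 B0 AG BG; rewrite -(fineK fing); move: (fine _) => G.
case: A => [a| |]//; case: B => [b| |]//=; rewrite !lee_fin => *.
by rewrite ler_norml; apply/andP; split; lra.
Qed.

End NonMeasurableBounds.

(** * Boundary traces of functions with values in [0,1] *)

Section Traces.
Context {R : realType}.
Local Notation mu := (@lebesgue_measure R).

(** A nonempty open interval has positive measure. *)
Lemma ae_unitI_dense (P : R -> Prop) (a b : R) :
  {ae mu, forall u, unitI u -> P u} -> 0 <= a -> a < b -> b <= 1 ->
  exists2 u, a < u < b & P u.
Proof.
move=> aeP a0 ab b1; apply: contrapT => nP.
have : mu.-negligible `]a, b[%classic.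
  apply: negligibleS aeP => u /=; rewrite in_itv/= => uab /(_ _)Pu; apply: nP.
  exists u => //; apply: Pu; rewrite /unitI/= in_itv/=.
  by case/andP: uab => *; apply/andP; split; lra.
move/negligibleP => /(_ (measurable_itv _)).
rewrite /= lebesgue_measure_itv/= lte_fin ab -EFinB => /eqP.
by rewrite eqe subr_eq0 gt_eqF.
Qed.

(* [C 0] accounts for the default value of [cont_rep] when there is no
   continuous representative. *)
Lemma cont_rep_closed (z : R -> R) (C : set R) (x : R) : closed C -> C 0 ->
  (forall u, unitI u -> C (z u)) -> unitI x -> C (cont_rep z x).
Proof.
move=> cC C0 zC Ix; rewrite /cont_rep.
case: xgetP => [f _ [cf aef]|_]; last exact: C0.
apply: contrapT => nCf.
have oC : nbhs (f x) (~` C) by apply: open_nbhs_nbhs; split; [exact: closed_openC|].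
have := cf x _ oC; rewrite /nbhs/= -nbhs_subspace_in//.
move=> /nbhs_ballP[e /= e0 He].
(* Clipping to [0,1] leaves a nonempty open interval, one-sided when [x] is an endpoint. *)
pose a := Num.max 0 (x - e / 2); pose b := Num.min 1 (x + e / 2).
have [x0 x1] : 0 <= x /\ x <= 1 by move: Ix; rewrite /unitI/= in_itv/= => /andP.
have [] := @ae_unitI_dense (fun u => f u = z u) a b aef.
- by rewrite /a le_max lexx.
- by rewrite /a /b gt_max !lt_min; apply/andP; split; apply/andP; split; lra.
- by rewrite /b ge_min lexx.
move=> u; rewrite /a /b gt_max lt_min => /andP[/andP[u0 ux] /andP[u1 xu]] fz.
have Iu : unitI u by rewrite /unitI/= in_itv/= !ltW.
suff xu_e : ball x e u by apply: (He u xu_e Iu); rewrite /from_subspace fz; exact: zC.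
by rewrite /ball/= ltr_norml; apply/andP; split; lra.
Qed.

Lemma cont_rep_jump (z : R -> R) : (forall u, unitI u -> 0 <= z u <= 1) ->
  `|cont_rep z 0 - cont_rep z 1| <= 1.
Proof.
move=> z01.
have I0 : unitI (0 : R) by rewrite /unitI/= in_itv/= lexx ler01.
have I1 : unitI (1 : R) by rewrite /unitI/= in_itv/= lexx ler01.
have U x : unitI x -> 0 <= cont_rep z x <= 1.
  move=> Ix; suff : `[0, 1]%classic (cont_rep z x) by rewrite /= in_itv.
  by apply: cont_rep_closed => //; exact: interval_closed.
have /andP[? ?] := U _ I0; have /andP[? ?] := U _ I1.
by rewrite ler_norml; apply/andP; split; lra.
Qed.

End Traces.

(** * Test functions with separated variables *)

Section TestFunctions.
Context {R : realType}.

Lemma is_derive_deriv_on (D : set R) (f : R -> R) (x l : R) :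
  is_derive x (1 : R) f l -> deriv_on D f x l.
Proof.
move=> [df dl].
have cv : h^-1 *: (f (h *: 1 + x) - f x) @[h --> 0^'] --> l.
  by rewrite -dl; exact: df.
apply/cvgrPdist_le => e e0.
move/cvgrPdist_le : cv => /(_ e e0) /nbhs_ballP[r /= r0 Hr].
apply/nbhs_ballP; exists r => //= y xy yx _.
have := Hr (y - x); rewrite /ball/= sub0r normrN distrC => /(_ xy).
rewrite subr_eq0 => /(_ yx).
by rewrite /GRing.scale/= mulr1 subrK mulrC.
Qed.

(* Solution, at time [s], of the backward heat equation with
   value [phi] at time [t] when [phi'' = - l phi]. *)
Definition backward_mode (l t : R) (phi : R -> R) (s u : R) : R :=
  expR (l * (s - t)) * phi u.

Lemma jcontinuous_backward_mode (A B : set R) l t phi : continuous phi ->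
  jcontinuous A B (backward_mode l t phi).
Proof.
move=> cphi; apply: continuous_subspaceT => -[s u].
apply: (@cvgM _ _ _ _ (fun x : R * R => expR (l * (x.1 - t)))
  (fun x : R * R => phi x.2)).
  apply: (@continuous_comp _ _ _ fst (fun s => expR (l * (s - t)))).
    exact: cvg_fst.
  exact: continuous_expRM.
apply: (@continuous_comp _ _ _ snd phi); last exact: cphi.
exact: cvg_snd.
Qed.

(** Stated for general [phi2], since the corrected sine mode used for large [a] is an eigenfunction
    only up to an error. *)
Lemma C12_backward_mode (A B : set R) l t (phi phi1 phi2 : R -> R) :
  continuous phi -> continuous phi1 -> continuous phi2 ->
  (forall u, is_derive u (1 : R) phi (phi1 u)) ->
  (forall u, is_derive u (1 : R) phi1 (phi2 u)) ->
  C12 A B (backward_mode l t phi) (fun s u => l * backward_mode l t phi s u)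
    (backward_mode l t phi1) (backward_mode l t phi2).
Proof.
move=> c0 c1 c2 d1 d2; split.
- split; try exact: jcontinuous_backward_mode.
  rewrite (_ : (fun s u => _) = backward_mode l t (fun u => l * phi u)).
    apply: jcontinuous_backward_mode => u; apply: cvgM; [exact: cvg_cst|exact: c0].
  by apply/funext => s; apply/funext => u; rewrite /backward_mode mulrCA.
- move=> s u _ _; apply: is_derive_deriv_on; rewrite /backward_mode.
  have := is_deriveZ (phi u) (is_derive_expRM l t s).
  rewrite /GRing.scale/= (_ : phi u * _ = l * (expR (l * (s - t)) * phi u)); last by ring.
  rewrite (_ : phi u \*: _ = fun r => expR (l * (r - t)) * phi u)//.
  by apply/funext => r; exact: mulrC.
- by move=> s u _ _; apply: is_derive_deriv_on; exact: is_deriveZ.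
- by move=> s u _ _; apply: is_derive_deriv_on; exact: is_deriveZ.
Qed.

End TestFunctions.

(** * Fourier coefficients of the weak solutions *)

Section Coefficients.
Context {R : realType}.
Variables (T : R) (rho0 : R -> R).
Implicit Types (rho : R -> R -> R) (phi : R -> R).

Local Notation mu := (@lebesgue_measure R).

Lemma normr_Rintegral_exp (l t c : R) (f : R -> R) : 0 < l -> 0 <= t -> 0 <= c ->
  (forall s, 0 <= s <= t -> `|f s| <= c * expR (l * (s - t))) ->
  `|\int[mu]_(s in timeI t) f s| <= c / l.
Proof.
move=> l0 t0 c0 fc.
have mt : measurable (timeI t) by exact: measurable_itv.
have ie : mu.-integrable (timeI t) (EFin \o (fun s => expR (l * (s - t)))).
  apply: continuous_compact_integrable; first exact: segment_compact.
  by apply: continuous_subspaceT; exact: continuous_expRM.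
have ice : mu.-integrable (timeI t) (EFin \o (fun s => c * expR (l * (s - t)))).
  rewrite (_ : EFin \o _ = (fun s => c%:E * (EFin \o (fun s => expR (l * (s - t)))) s)%E);
    last by apply/funext => s /=; rewrite EFinM.
  exact: integrableZl.
apply: le_trans (normr_Rintegral_le ice _ mt) _.
  by move=> s; rewrite /timeI/= in_itv/=; exact: fc.
rewrite RintegralZl// ler_wpM2l//; exact: Rintegral_expRM.
Qed.

Lemma Rintegral_zero (D : set R) (f : R -> R) : (forall x, D x -> f x = 0) ->
  \int[mu]_(x in D) f x = 0.
Proof. by move=> f0; rewrite /Rintegral integral0_eq// => x /f0 ->. Qed.

Lemma inner_zero f g : (forall u, unitI u -> g u = 0) -> inner f g = 0 :> R.
Proof. by move=> g0; apply: Rintegral_zero => u /g0 ->; rewrite mulr0. Qed.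

Lemma backward_mode_final (l t : R) phi : backward_mode l t phi t = phi.
Proof. by apply/funext => u; rewrite /backward_mode subrr mulr0 expR0 mul1r. Qed.

(** The time derivative of the mode cancels its Laplacian, so only the two end times contribute. *)
Lemma bulk_backward_mode rho (l t : R) phi phi2 : (forall u, phi2 u = - (l * phi u)) ->
  bulk_terms rho0 rho (backward_mode l t phi) (fun s u => l * backward_mode l t phi s u)
    (backward_mode l t phi2) t =
  inner (rho t) phi - inner rho0 (backward_mode l t phi 0).
Proof.
move=> E; rewrite /bulk_terms backward_mode_final Rintegral_zero ?subr0// => s _.
by apply: inner_zero => u _; rewrite /backward_mode E; ring.
Qed.

Lemma C12_cos (A B : set R) (w t : R) :
  C12 A B (backward_mode (w ^+ 2) t (fun u => cos (w * u)))
    (fun s u => w ^+ 2 * backward_mode (w ^+ 2) t (fun u => cos (w * u)) s u)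
    (backward_mode (w ^+ 2) t (fun u => - (w * sin (w * u))))
    (backward_mode (w ^+ 2) t (fun u => - (w * (w * cos (w * u))))).
Proof.
apply: C12_backward_mode.
- exact: continuous_cosM.
- move=> u; apply: cvgN; apply: cvgM; [exact: cvg_cst|exact: continuous_sinM].
- move=> u; apply: cvgN; apply: cvgM; first exact: cvg_cst.
  by apply: cvgM; [exact: cvg_cst|exact: continuous_cosM].
- exact: is_derive_cosM.
- move=> u; have := is_deriveN (is_deriveZ w (is_derive_sinM w u)).
  exact.
Qed.

Lemma C12_sin (A B : set R) (w t : R) :
  C12 A B (backward_mode (w ^+ 2) t (fun u => sin (w * u)))
    (fun s u => w ^+ 2 * backward_mode (w ^+ 2) t (fun u => sin (w * u)) s u)
    (backward_mode (w ^+ 2) t (fun u => w * cos (w * u)))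
    (backward_mode (w ^+ 2) t (fun u => w * - (w * sin (w * u)))).
Proof.
apply: C12_backward_mode.
- exact: continuous_sinM.
- move=> u; apply: cvgM; [exact: cvg_cst|exact: continuous_cosM].
- move=> u; apply: cvgM; first exact: cvg_cst.
  by apply: cvgN; apply: cvgM; [exact: cvg_cst|exact: continuous_sinM].
- exact: is_derive_sinM.
- by move=> u; have := is_deriveZ w (is_derive_cosM w u); exact.
Qed.

(** The derivative of the test function vanishes at 0 and 1, so the coefficient depends on the
    initial condition alone. *)
Lemma neumann_cosine rhoN t k : weak_neumann T rho0 rhoN -> 0 <= t <= T ->
  inner (rhoN t) (cosine_basis k) =
  inner rho0 (backward_mode ((k%:R * pi) ^+ 2) t (cosine_basis k) 0).
Proof.
move=> [_ _ wN] tT; have := wN t _ _ _ _ tT (C12_cos _ _ (k%:R * pi) t).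
rewrite bulk_backward_mode => [|u]; last by ring.
rewrite [boundary_terms _ _ _]Rintegral_zero ?subr0 => [/eqP|s _].
  by rewrite subr_eq0 => /eqP.
by rewrite /backward_mode !mulr0 sin0 mulr1 pmulrn sin_intpi !(mulr0, oppr0, addr0).
Qed.

Lemma robin_cosine a rho t k : weak_robin T rho0 a rho -> 0 <= t <= T ->
  inner (rho t) (cosine_basis k) =
  inner rho0 (backward_mode ((k%:R * pi) ^+ 2) t (cosine_basis k) 0) -
  robin_terms a rho (backward_mode ((k%:R * pi) ^+ 2) t (cosine_basis k)) t.
Proof.
move=> [_ _ wR] tT; have := wR t _ _ _ _ tT (C12_cos _ _ (k%:R * pi) t).
rewrite bulk_backward_mode => [|u]; last by ring.
rewrite [boundary_terms _ _ _]Rintegral_zero ?subr0 => [|s _].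
  by rewrite -/(cosine_basis k) => E; lra.
by rewrite /backward_mode !mulr0 sin0 mulr1 pmulrn sin_intpi !(mulr0, oppr0, addr0).
Qed.

(* For [k = 0] the bound is [0], since [0^-1 = 0]. *)
Lemma robin_neumann_cosine a rho rhoN t k : 0 < a ->
  (forall s u, 0 <= s <= T -> 0 <= u <= 1 -> 0 <= rho s u <= 1) ->
  weak_robin T rho0 a rho -> weak_neumann T rho0 rhoN -> 0 <= t <= T ->
  `|inner (rho t) (cosine_basis k) - inner (rhoN t) (cosine_basis k)| <=
  2 * a / k%:R.
Proof.
move=> a0 rho01 wR wN tT; have [t0 tT'] := andP tT.
rewrite (robin_cosine k wR tT) (neumann_cosine k wN tT) addrAC subrr add0r normrN.
have [->|k0] := eqVneq k 0%N.
  rewrite /robin_terms Rintegral_zero ?normr0 ?invr0 ?mulr0// => s _.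
  by rewrite /backward_mode /cosine_basis !mul0r subrr mulr0.
have k1 : 1 <= k%:R :> R by rewrite ler1n lt0n.
have P2 := pi_ge2 R.
have l0 : 0 < (k%:R * pi : R) ^+ 2 by rewrite exprn_gt0// mulr_gt0//; lra.
(* The trace jump is at most 1 and the cosine jump at most 2. The resulting quadratic decay is then
   weakened to [k%:R^-1], whose squares are still summable. *)
apply: (@le_trans _ _ (2 * a / (k%:R * pi) ^+ 2)).
  rewrite /robin_terms; apply: normr_Rintegral_exp => //.
    by rewrite mulr_ge0// ltW.
  move=> s /andP[s0 st]; rewrite /backward_mode -mulrBr.
  set e := expR _; have e0 : 0 <= e by exact: expR_ge0.
  rewrite !normrM (ger0_norm e0) (gtr0_norm a0).
  have J : `|cont_rep (rho s) 0 - cont_rep (rho s) 1| <= 1.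
    apply: cont_rep_jump => u; rewrite /unitI/= in_itv/=; apply: rho01.
    by rewrite s0 (le_trans st).
  have C : `|cosine_basis k (0 : R) - cosine_basis k 1| <= 2.
    rewrite (le_trans (ler_normB _ _))// (natrD _ 1 1).
    by apply: lerD; exact: cos_max.
  rewrite [leRHS](_ : _ = a * 1 * (e * 2)); last by ring.
  by rewrite !ler_pM ?mulr_ge0 ?(ltW a0).
rewrite ler_pM2l ?mulr_gt0// lef_pV2 ?posrE//; last by lra.
have kp : k%:R <= k%:R * pi :> R by rewrite ler_peMr//; lra.
by rewrite expr2 (le_trans kp)// ler_peMr; lra.
Qed.

Lemma periodic_cosM (m : int) : periodic (fun u : R => cos (2 * (m%:~R * pi) * u)) 1.
Proof.
by move=> u; rewrite mulrDr mulr1 cosD cos_int2pi sin_int2pi mulr1 mulr0 subr0.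
Qed.

Lemma periodic_sinM (m : int) : periodic (fun u : R => sin (2 * (m%:~R * pi) * u)) 1.
Proof.
by move=> u; rewrite mulrDr mulr1 sinD cos_int2pi sin_int2pi mulr1 mulr0 addr0.
Qed.

Lemma periodic_test rhoP t (w : R) phi phi1 phi2 :
  C12 (timeI T) setT (backward_mode (w ^+ 2) t phi)
    (fun s u => w ^+ 2 * backward_mode (w ^+ 2) t phi s u)
    (backward_mode (w ^+ 2) t phi1) (backward_mode (w ^+ 2) t phi2) ->
  (forall u, phi2 u = - (w ^+ 2 * phi u)) -> periodic phi 1 ->
  weak_periodic T rho0 rhoP -> 0 <= t <= T ->
  inner (rhoP t) phi = inner rho0 (backward_mode (w ^+ 2) t phi 0).
Proof.
move=> C E per [_ _ wP] tT; have := wP t _ _ _ _ tT C.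
rewrite bulk_backward_mode// => /(_ _)/eqP; rewrite subr_eq0 => H.
by apply/eqP/H => s _ u; rewrite /backward_mode per.
Qed.

Lemma periodic_cos rhoP t (m : int) : weak_periodic T rho0 rhoP -> 0 <= t <= T ->
  inner (rhoP t) (fun u => cos (2 * (m%:~R * pi) * u)) = inner rho0
    (backward_mode ((2 * (m%:~R * pi)) ^+ 2) t (fun u => cos (2 * (m%:~R * pi) * u)) 0).
Proof.
apply: periodic_test (C12_cos _ _ _ t) _ _ => [u|]; first by ring.
exact: periodic_cosM.
Qed.

Lemma periodic_sin rhoP t (m : int) : weak_periodic T rho0 rhoP -> 0 <= t <= T ->
  inner (rhoP t) (fun u => sin (2 * (m%:~R * pi) * u)) = inner rho0
    (backward_mode ((2 * (m%:~R * pi)) ^+ 2) t (fun u => sin (2 * (m%:~R * pi) * u)) 0).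
Proof.
apply: periodic_test (C12_sin _ _ _ t) _ _ => [u|]; first by ring.
exact: periodic_sinM.
Qed.

(** The sine derivative vanishes at both ends and the cosine has no jump between them, so both
    solutions have the coefficient dictated by [rho0]. *)
Lemma robin_cos a rho rhoP t (m : int) :
  weak_robin T rho0 a rho -> weak_periodic T rho0 rhoP -> 0 <= t <= T ->
  inner (rho t) (fun u => cos (2 * (m%:~R * pi) * u)) =
  inner (rhoP t) (fun u => cos (2 * (m%:~R * pi) * u)).
Proof.
move=> [_ _ wR] wP tT; rewrite (periodic_cos m wP tT).
have := wR t _ _ _ _ tT (C12_cos _ _ (2 * (m%:~R * pi)) t).
rewrite bulk_backward_mode => [|u]; last by ring.
rewrite [boundary_terms _ _ _]Rintegral_zero ?subr0 => [|s _]; last first.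
  by rewrite /backward_mode mulr0 mulr1 sin0 sin_int2pi !(mulr0, oppr0, addr0).
rewrite [robin_terms _ _ _ _]Rintegral_zero ?addr0 => [|s _].
  by move=> E; lra.
by rewrite /backward_mode mulr0 mulr1 cos0 cos_int2pi subrr mulr0.
Qed.

(** The sine vanishes at both ends, which removes the Robin term; the boundary term is [w] times the
    trace jump and integrates to at most [w / w ^+ 2]. Being uniform in [a], the bound controls high
    frequencies. *)
Lemma robin_sin_le a rho rhoP t (n : nat) : 0 < a ->
  (forall s u, 0 <= s <= T -> 0 <= u <= 1 -> 0 <= rho s u <= 1) ->
  weak_robin T rho0 a rho -> weak_periodic T rho0 rhoP -> 0 <= t <= T ->
  (0 < n)%N ->
  `|inner (rho t) (fun u => sin (2 * (n%:Z%:~R * pi) * u)) -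
    inner (rhoP t) (fun u => sin (2 * (n%:Z%:~R * pi) * u))| <= (n%:R)^-1.
Proof.
move=> a0 rho01 [_ _ wR] wP tT n0; rewrite (periodic_sin n wP tT).
have [t0 tT'] := andP tT.
have := wR t _ _ _ _ tT (C12_sin _ _ (2 * (n%:Z%:~R * pi)) t).
rewrite bulk_backward_mode => [|u]; last by ring.
rewrite [robin_terms _ _ _ _]Rintegral_zero ?addr0 => [|s _]; last first.
  by rewrite /backward_mode mulr0 mulr1 sin0 sin_int2pi subrr mulr0.
move/eqP; rewrite subr_eq0 => /eqP ->.
set w : R := 2 * _; have P2 := pi_ge2 R.
have n1 : 1 <= n%:R :> R by rewrite ler1n.
have nw : n%:R <= w by rewrite /w -pmulrn; nra.
have w0 : 0 < w by lra.
apply: (@le_trans _ _ (w / w ^+ 2)); last first.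
  rewrite expr2 invfM mulrA divff ?mul1r ?gt_eqF//.
  by rewrite lef_pV2 ?posrE//; lra.
rewrite /boundary_terms; apply: normr_Rintegral_exp => //; first exact: exprn_gt0.
  exact: ltW.
move=> s /andP[s0 st]; rewrite /backward_mode mulr0 mulr1 cos0 cos_int2pi mulr1.
rewrite -mulrBl; set e := expR _; have e0 : 0 <= e by exact: expR_ge0.
have J : `|cont_rep (rho s) 0 - cont_rep (rho s) 1| <= 1.
  apply: cont_rep_jump => u; rewrite /unitI/= in_itv/=; apply: rho01.
  by rewrite s0 (le_trans st).
rewrite normrM [in leLHS](ger0_norm (mulr_ge0 e0 (ltW w0))) [w * e]mulrC.
by rewrite ler_piMl// mulr_ge0// ltW.
Qed.

(** All time integrals vanish at [t = 0]. This replaces [rho0] in inner products by [rho 0], which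
    is in L^2. *)
Lemma robin_time0 a rho H Hs Hu Huu : 0 <= T -> weak_robin T rho0 a rho ->
  C12 (timeI T) unitI H Hs Hu Huu -> inner (rho 0) (H 0) = inner rho0 (H 0).
Proof.
move=> T0 [_ _ wR] C; have := wR 0 _ _ _ _ _ C; rewrite lexx T0 => /(_ isT).
have I0 (f : R -> R) : \int[mu]_(s in timeI 0) f s = 0.
  by rewrite /timeI set_itv1 Rintegral_set1.
rewrite /bulk_terms /boundary_terms /robin_terms !I0 !subr0 addr0 => /eqP.
by rewrite subr_eq0 => /eqP.
Qed.

End Coefficients.

(** * Sine coefficients for large [a], and a tail sum *)

Section MeanSquare.
Context {R : realType}.
Variables (T : R) (rho0 : R -> R).
Implicit Types (rho : R -> R -> R) (f g : R -> R).

Local Notation mu := (@lebesgue_measure R).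

(** Truncation supplies the measurability on the whole line that [square_integrable] demands. *)
Lemma L2_square_integrable f : L2 f -> square_integrable (f \_ unitI).
Proof.
move=> f2; have i2 := Lfun2_integrable_sqr f2; split.
  by move: f2; rewrite /L2 inE => /andP[/[!inE]/= mf _].
by apply: integrableS i2 => //; exact: measurable_unitI.
Qed.

Lemma inner_restrict f g : inner (f \_ unitI) g = inner f g.
Proof. by apply: eq_Rintegral => u uI; rewrite /patch uI. Qed.

Lemma inner_lin_L2 f g h (c : R) : L2 f -> square_integrable g ->
  square_integrable h ->
  inner f (fun u => g u + c * h u) = inner f g + c * inner f h.
Proof.
move=> /L2_square_integrable sf sg sh.
by rewrite -!(inner_restrict f) innerC inner_lin// (innerC g) (innerC h).
Qed.

Lemma normr_inner_le f g (c : R) : (forall u, unitI u -> `|f u| <= 1) ->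
  (forall u, unitI u -> `|g u| <= c) -> `|inner f g| <= c.
Proof.
move=> f1 gc; have ic : mu.-integrable unitI (EFin \o (fun=> c)).
  apply: continuous_compact_integrable; first exact: segment_compact.
  by apply: continuous_subspaceT => u; exact: cvg_cst.
rewrite /inner; apply: le_trans (normr_Rintegral_le ic _ measurable_unitI) _.
  move=> u Iu; rewrite normrM -[leRHS]mul1r; apply: ler_pM => //; [exact: f1|exact: gc].
rewrite Rintegral_cst; last exact: measurable_unitI.
by rewrite /= /unitI lebesgue_measure_itv/= lte_fin ltr01 -EFinB subr0 mulr1.
Qed.

(* [sin (w u) + e cos (pi u)] with [e = pi n / a] satisfies the Robin boundary
   conditions exactly, and solves the eigenvalue equation up to O(1 / a). *)
Lemma robin_sin_decay a rho rhoP t (n : nat) : 0 < a ->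
  (forall s u, 0 <= s <= T -> 0 <= u <= 1 -> 0 <= rho s u <= 1) ->
  weak_robin T rho0 a rho -> weak_periodic T rho0 rhoP -> 0 <= t <= T ->
  (0 < n)%N ->
  `|inner (rho t) (fun u => sin (2 * (n%:Z%:~R * pi) * u)) -
    inner (rhoP t) (fun u => sin (2 * (n%:Z%:~R * pi) * u))| <=
  3 * (n%:R * pi / a).
Proof.
move=> a0 rho01 wR wP tT n0; rewrite (periodic_sin n wP tT).
have [t0 tT'] := andP tT; have T0 := le_trans t0 tT'.
set w : R := 2 * _; set e := n%:R * pi / a.
have P2 := pi_ge2 R.
have n1 : 1 <= n%:R :> R by rewrite ler1n.
have wE : w = 2 * (n%:R * pi) by rewrite /w -pmulrn.
have pw : pi <= w by rewrite wE; nra.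
have e0 : 0 < e by rewrite divr_gt0// mulr_gt0//; lra.
have ae : a * (e * 2) = w by rewrite wE /e; field; rewrite gt_eqF.
have cw : cos w = 1 by exact: cos_int2pi.
have sw : sin w = 0 by exact: sin_int2pi.
pose phi u := sin (w * u) + e * cos (pi * u).
pose phi1 u := w * cos (w * u) + e * - (pi * sin (pi * u)).
pose phi2 u := w * - (w * sin (w * u)) + e * - (pi * (pi * cos (pi * u))).
have C : C12 (timeI T) unitI (backward_mode (w ^+ 2) t phi)
    (fun s u => w ^+ 2 * backward_mode (w ^+ 2) t phi s u)
    (backward_mode (w ^+ 2) t phi1) (backward_mode (w ^+ 2) t phi2).
  have cs := @continuous_sinM R w; have cc := @continuous_cosM R w.
  have cs' := @continuous_sinM R pi; have cc' := @continuous_cosM R pi.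
  have ck (k : R) (h : R -> R) : continuous h -> continuous (fun u => k * h u).
    by move=> ch u; apply: cvgM; [exact: cvg_cst|exact: ch].
  have cD (h h' : R -> R) : continuous h -> continuous h' ->
      continuous (fun u => h u + h' u).
    by move=> ch ch' u; apply: cvgD; [exact: ch|exact: ch'].
  have cN (h : R -> R) : continuous h -> continuous (fun u => - h u).
    by move=> ch u; apply: cvgN; exact: ch.
  apply: C12_backward_mode.
  - exact: cD cs (ck e _ cc').
  - exact: cD (ck w _ cc) (ck e _ (cN _ (ck pi _ cs'))).
  - exact: cD (ck w _ (cN _ (ck w _ cs))) (ck e _ (cN _ (ck pi _ (ck pi _ cc')))).
  - move=> u.
    exact: (is_deriveD (is_derive_sinM w u) (is_deriveZ e (is_derive_cosM pi u))).
  - move=> u.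
    exact: (is_deriveD (is_deriveZ w (is_derive_cosM w u))
      (is_deriveZ e (is_deriveN (is_deriveZ pi (is_derive_sinM pi u))))).
have [L2r _ wR'] := wR; have := wR' t _ _ _ _ tT C.
rewrite /bulk_terms backward_mode_final -(robin_time0 T0 wR C).
set X := \int[mu]_(s in timeI t) _.
(* Here [phi 0 - phi 1 = 2 * e] and [phi1 0 = phi1 1 = w]; the choice of [e] makes
   [a * (2 * e) = w], so the two terms coincide and cancel in the weak formulation. *)
have -> : robin_terms a rho (backward_mode (w ^+ 2) t phi) t =
    boundary_terms rho (backward_mode (w ^+ 2) t phi1) t.
  apply: eq_Rintegral => s _; rewrite /backward_mode /phi /phi1; set E := expR _.
  rewrite !mulr0 !mulr1 !(sin0, cos0, sinpi, cospi) cw sw.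
  rewrite [in RHS](_ : w = a * (e * 2)); last by rewrite ae.
  by ring.
(* The sine part solves the backward equation exactly. The corrector leaves a residual of size at
   most [e * w ^+ 2] times the exponential, which integrates to at most [e]. *)
have Xe : `|X| <= e.
  have le : e * w ^+ 2 / w ^+ 2 = e.
    by field; rewrite gt_eqF//; lra.
  rewrite -[leRHS]le; apply: normr_Rintegral_exp => //.
  - by rewrite exprn_gt0//; lra.
  - by rewrite mulr_ge0 ?sqr_ge0 ?ltW.
  move=> s /andP[s0 st]; apply: normr_inner_le => u Iu.
    have /andP[? ?] : 0 <= rho s u <= 1.
      by apply: rho01; [rewrite s0 (le_trans st)|move: Iu; rewrite /unitI/= in_itv].
    by rewrite ler_norml; apply/andP; split; lra.
  rewrite /backward_mode -/(phi2 u); set E := expR _.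
  have E0 : 0 <= E by exact: expR_ge0.
  have -> : w ^+ 2 * (E * phi u) + E * phi2 u =
      (e * (w ^+ 2 - pi ^+ 2) * E) * cos (pi * u) by rewrite /phi /phi2; ring.
  have W : 0 <= w ^+ 2 - pi ^+ 2 <= w ^+ 2 by apply/andP; split; nra.
  have [W1 W2] := andP W.
  have [Y1 Y2] : 0 <= e * (w ^+ 2 - pi ^+ 2) * E /\
      e * (w ^+ 2 - pi ^+ 2) * E <= e * w ^+ 2 * E.
    have e0' := ltW e0; split; first exact: mulr_ge0 (mulr_ge0 e0' W1) E0.
    apply: (ler_wpM2r E0); exact: (ler_wpM2l e0' W2).
  rewrite normrM (ger0_norm Y1); apply: le_trans Y2.
  by rewrite ler_piMr// cos_max.
have ss := @square_integrable_sinM R w; have sc := @square_integrable_cosM R pi.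
have sb h : square_integrable h -> square_integrable (backward_mode (w ^+ 2) t h 0).
  move=> sh; have := square_integrable_lin (expR (w ^+ 2 * (0 - t)) - 1) sh sh.
  by congr square_integrable; apply/funext => u; rewrite /backward_mode; ring.
rewrite inner_lin_L2//; last exact: L2r.
rewrite (_ : backward_mode (w ^+ 2) t phi 0 = fun u =>
    backward_mode (w ^+ 2) t (fun u => sin (w * u)) 0 u +
    e * backward_mode (w ^+ 2) t (fun u => cos (pi * u)) 0 u); last first.
  by apply/funext => u; rewrite /backward_mode /phi; ring.
rewrite inner_lin_L2; [|by apply: L2r; rewrite lexx|exact: sb|exact: sb].
rewrite -(robin_time0 T0 wR (C12_sin _ _ w t)).
have B s (g : R -> R) : 0 <= s <= T -> (forall u, unitI u -> `|g u| <= 1) ->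
    `|inner (rho s) g| <= 1.
  move=> sT; apply: normr_inner_le => u.
  rewrite /unitI/= in_itv/= => /(rho01 _ _ sT) /andP[? ?].
  by rewrite ler_norml; apply/andP; split; lra.
have : `|inner (rho t) (fun u => cos (pi * u))| <= 1.
  by apply: B => // u _; exact: cos_max.
have : `|inner (rho 0) (backward_mode (w ^+ 2) t (fun u => cos (pi * u)) 0)| <= 1.
  apply: B => [|u _]; first by rewrite lexx.
  rewrite /backward_mode normrM ger0_norm ?expR_ge0// mulr_ile1 ?expR_ge0 ?cos_max//.
  by rewrite -expR0 ler_expR sub0r mulrN oppr_le0 mulr_ge0 ?sqr_ge0.
move: Xe; rewrite !ler_norml.
set c0 := inner (rho 0) _; set ct := inner (rho t) (fun u => cos _).
set st := inner (rho t) _; set s0 := inner (rho 0) _.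
move=> /andP[X1 X2] /andP[c1 c2] /andP[d1 d2] H.
(* Three contributions of size at most [e]: the residual and the corrector at times 0 and [t]. *)
have -> : st - s0 = X + e * c0 - e * ct by lra.
by apply/andP; split; nra.
Qed.

(** Telescoping, from [1 / N ^+ 2 <= 2 / (N * (N + 1)) = 2 / N - 2 / (N + 1)] for [N >= 1]. *)
Lemma sum_inv_sqr (K N : nat) : (0 < K <= N)%N ->
  \sum_(K <= k < N) (k%:R^-1) ^+ 2 <= 2 / K%:R - 2 / N%:R :> R.
Proof.
move=> /andP[K0]; elim: N => [|N IH]; first by rewrite leqn0 => /eqP ->; rewrite big_geq// subrr.
rewrite leq_eqVlt => /predU1P[->|]; first by rewrite big_geq// subrr.
rewrite ltnS => KN; rewrite big_nat_recr//=.
apply: le_trans (lerD (IH KN) (lexx _)) _.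
have N1 : 1 <= N%:R :> R by rewrite ler1n (leq_trans K0).
suff : (N%:R^-1 : R) ^+ 2 <= 2 / N%:R - 2 / N.+1%:R.
  by set x := 2 / N.+1%:R; set y := 2 / N%:R; set z := _ ^+ 2; lra.
rewrite -[N.+1%:R]natr1 (_ : 2 / N%:R - 2 / (N%:R + 1) = 2 / (N%:R * (N%:R + 1)) :> R); last first.
  by field; apply/andP; split; rewrite gt_eqF//; lra.
have NN : 0 < N%:R * N%:R :> R by nra.
have NS : 0 < N%:R * (N%:R + 1) :> R by nra.
by rewrite expr2 -invfM ler_pdivlMr// mulrC ler_pdivrMr//; nra.
Qed.

End MeanSquare.

(** * Estimates uniform in time and passage to the limit *)

Section Limits.
Context {R : realType}.
Variables (T : R) (rho0 : R -> R).
Hypothesis T0 : 0 < T.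
Implicit Types (rho : R -> R -> R) (f g : R -> R).

Local Notation mu := (@lebesgue_measure R).

(** The Parseval inequality is a hypothesis so that both trigonometric systems can be used. *)
Lemma sqdist_coef_le (b : nat -> R -> R) f g (M : R) :
  (forall h e, square_integrable h -> 0 < e ->
    exists N, inner h h <= e + \sum_(k < N) 2 * inner h (b k) ^+ 2) ->
  (forall k, square_integrable (b k)) -> L2 f -> L2 g ->
  (forall N, \sum_(k < N) 2 * (inner f (b k) - inner g (b k)) ^+ 2 <= M) ->
  (sqdist f g <= M%:E)%E.
Proof.
move=> parseval sb f2 g2 SM.
have sf := L2_square_integrable f2; have sg := L2_square_integrable g2.
have -> : sqdist f g = sqdist (f \_ unitI) (g \_ unitI).
  by apply: eq_integral => u uI; rewrite /patch uI.
rewrite sqdist_inner// lee_fin.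
set w := (fun u => _); have wE : w = fun u => (f \_ unitI) u + -1 * (g \_ unitI) u.
  by apply/funext => u; rewrite /w mulN1r.
have sw : square_integrable w by rewrite wE; exact: square_integrable_lin.
apply/ler_addgt0Pr => e e0; have [N /le_trans] := parseval w e sw e0; apply.
rewrite addrC lerD2r; apply: le_trans (SM N).
rewrite le_eqVlt; apply/orP; left; apply/eqP; apply: eq_bigr => k _.
by rewrite wE inner_lin// !inner_restrict mulN1r.
Qed.

Lemma robin_neumann_sqdist a rho rhoN t : 0 < a ->
  (forall s u, 0 <= s <= T -> 0 <= u <= 1 -> 0 <= rho s u <= 1) ->
  weak_robin T rho0 a rho -> weak_neumann T rho0 rhoN -> 0 <= t <= T ->
  (sqdist (rho t) (rhoN t) <= (16 * a ^+ 2)%:E)%E.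
Proof.
move=> a0 rho01 wR wN tT.
apply: (@sqdist_coef_le cosine_basis).
- exact: parseval_cosine.
- exact: cosine_basis_square_integrable.
- by case: wR => + _ _; exact.
- by case: wN => + _ _; exact.
move=> N.
apply: (@le_trans _ _ (\sum_(k < N) 8 * a ^+ 2 * (k%:R^-1) ^+ 2)).
  apply: ler_sum => k _.
  have := robin_neumann_cosine k a0 rho01 wR wN tT.
  rewrite (_ : 8 * a ^+ 2 * (k%:R^-1) ^+ 2 = 2 * (2 * a / k%:R) ^+ 2); last by ring.
  move=> H; rewrite ler_pM2l// -[leLHS]real_normK ?num_real// ler_sqr ?nnegrE//.
  by rewrite divr_ge0 ?mulr_ge0 ?(ltW a0).
rewrite -mulr_sumr (_ : 16 * a ^+ 2 = 8 * a ^+ 2 * 2); last by ring.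
rewrite ler_wpM2l ?mulr_ge0 ?(ltW a0)//.
have -> : \sum_(k < N) (k%:R^-1 : R) ^+ 2 = \sum_(0 <= k < N) (k%:R^-1 : R) ^+ 2.
  by rewrite big_mkord.
case: N => [|N]; first by rewrite big_geq.
(* The term [k = 0] vanishes since [0^-1 = 0]; the rest sums to at most 2. *)
rewrite big_ltn// invr0 expr0n add0r.
apply: le_trans (@sum_inv_sqr R 1 N.+1 isT) _.
by rewrite divr1 gerBl divr_ge0.
Qed.

(** The first bound serves large [k], the second large [a] at fixed [k]. Index [k = m.*2.+1] carries
    frequency [m.+1], with [m.+1 <= k <= 2 * m.+1]; this and [pi <= 4] give the constants 2 and
    12. *)
Lemma robin_periodic_fourier a rho rhoP t k : 0 < a ->
  (forall s u, 0 <= s <= T -> 0 <= u <= 1 -> 0 <= rho s u <= 1) ->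
  weak_robin T rho0 a rho -> weak_periodic T rho0 rhoP -> 0 <= t <= T ->
  `|inner (rho t) (fourier_basis k) - inner (rhoP t) (fourier_basis k)| <= 2 / k%:R /\
  `|inner (rho t) (fourier_basis k) - inner (rhoP t) (fourier_basis k)| <=
    12 / a * k%:R.
Proof.
move=> a0 rho01 wR wP tT; elim/nat_parity_ind: k => m.
  have -> : fourier_basis m.*2 = fun u => cos (2 * (m%:Z%:~R * pi) * u) :> R.
    by apply/funext => u; exact: fourier_even.
  rewrite (robin_cos m wR wP tT) subrr normr0.
  by rewrite divr_ge0// mulr_ge0// divr_ge0// ltW.
have -> : fourier_basis m.*2.+1 = fun u => sin (2 * (m.+1%:Z%:~R * pi) * u) :> R.
  by apply/funext => u; exact: fourier_odd.
have M1 : 1 <= m.+1%:R :> R by rewrite ler1n.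
have ME : m.*2.+1%:R = 2 * m.+1%:R - 1 :> R.
  by rewrite -!natr1 -muln2 natrM; ring.
split.
  apply: le_trans (robin_sin_le a0 rho01 wR wP tT (ltn0Sn m)) _.
  rewrite ler_pdivlMr ?ltr0n// mulrC ler_pdivrMr ?ltr0n// ME; lra.
apply: le_trans (robin_sin_decay a0 rho01 wR wP tT (ltn0Sn m)) _.
rewrite (_ : 3 * (m.+1%:R * pi / a) = (3 * m.+1%:R * pi) / a); last by ring.
rewrite (_ : 12 / a * _ = (12 * m.*2.+1%:R) / a); last by ring.
rewrite ler_pM2r ?invr_gt0// ME.
have p4 : pi <= 4 :> R by have := pihalf_lt2 R; lra.
have P0 := pi_gt0 R; nra.
Qed.

(** The coefficients are split at [K]: the tail is at most [16 / K], uniformly in [a], and the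
    finitely many remaining terms add up to at most [S / a ^+ 2]. Each part is made at most
    [e / 2]. *)
Lemma robin_periodic_sqdist (e : R) : 0 < e -> exists2 A : R, 0 < A &
  forall a rho rhoP t, A <= a ->
  (forall s u, 0 <= s <= T -> 0 <= u <= 1 -> 0 <= rho s u <= 1) ->
  weak_robin T rho0 a rho -> weak_periodic T rho0 rhoP -> 0 <= t <= T ->
  (sqdist (rho t) (rhoP t) <= e%:E)%E.
Proof.
move=> e0; pose K := (Num.truncn (32 / e)).+1.
have K0 : 0 < K%:R :> R by rewrite ltr0n.
have Ke : 16 / K%:R <= e / 2.
  rewrite ler_pdivrMr// mulrC -ler_pdivrMr ?divr_gt0//.
  rewrite (_ : 16 / (e / 2) = 32 / e); last by field; rewrite gt_eqF.
  by rewrite ltW// truncnS_gt.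
(* The constant is [2 * 12 ^+ 2], from the second coefficient bound. *)
pose S : R := \sum_(k < K) 288 * k%:R ^+ 2.
have S0 : 0 <= S by apply: sumr_ge0 => k _; rewrite mulr_ge0 ?sqr_ge0.
have SA : 0 <= 2 * S / e by apply: divr_ge0; [exact: mulr_ge0|exact: ltW].
(* Then [a >= 1] gives [a <= a ^+ 2], and [a >= 2 * S / e] gives [S / a ^+ 2 <= e / 2]. *)
exists (1 + 2 * S / e); first by lra.
move=> a rho rhoP t Aa rho01 wR wP tT.
have a1 : 1 <= a by lra.
have a0 : 0 < a by lra.
have Sa : S / a ^+ 2 <= e / 2.
  rewrite ler_pdivrMr ?exprn_gt0//.
  have : 2 * S <= a * e by rewrite -ler_pdivrMr//; lra.
  by nra.
apply: (@sqdist_coef_le fourier_basis).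
- exact: parseval_fourier.
- exact: fourier_basis_square_integrable.
- by case: wR => + _ _; exact.
- by case: wP => + _ _; exact.
move=> N.
pose c k := 2 * (inner (rho t) (fourier_basis k) - inner (rhoP t) (fourier_basis k)) ^+ 2.
have sq (x y : R) : `|x| <= y -> 2 * x ^+ 2 <= 2 * y ^+ 2.
  move=> xy; rewrite ler_pM2l// -[leLHS]real_normK ?num_real// ler_sqr ?nnegrE//.
  exact: le_trans (normr_ge0 _) xy.
have c0 k : 0 <= c k by rewrite /c mulr_ge0 ?sqr_ge0.
have c1 k : c k <= 8 * (k%:R^-1) ^+ 2.
  have [H _] := robin_periodic_fourier k a0 rho01 wR wP tT.
  by apply: le_trans (sq _ _ H) _; rewrite le_eqVlt; apply/orP; left; apply/eqP; ring.
have c2 k : c k <= 288 * k%:R ^+ 2 / a ^+ 2.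
  have [_ H] := robin_periodic_fourier k a0 rho01 wR wP tT.
  apply: le_trans (sq _ _ H) _; rewrite le_eqVlt; apply/orP; left; apply/eqP.
  by field; rewrite gt_eqF.
(* Enlarging the range to [maxn K N] allows the split at [K] even when [N < K]. *)
apply: (@le_trans _ _ (\sum_(0 <= k < maxn K N) c k)).
  rewrite (big_cat_nat _ (leq_maxr K N))//= big_mkord lerDl.
  exact: sumr_ge0.
rewrite (big_cat_nat _ (leq_maxl K N))//=.
have -> : e = e / 2 + e / 2 by lra.
apply: lerD.
  apply: le_trans Sa; rewrite big_mkord mulr_suml; apply: ler_sum => k _.
  exact: c2.
apply: le_trans Ke.
apply: (@le_trans _ _ (\sum_(K <= k < maxn K N) 8 * (k%:R^-1) ^+ 2)).
  by apply: ler_sum => k _; exact: c1.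
rewrite -mulr_sumr (_ : 16 / K%:R = 8 * (2 / K%:R)); last by ring.
rewrite ler_pM2l//; apply: le_trans (@sum_inv_sqr R K (maxn K N) _) _.
  by rewrite leq_maxl.
by rewrite gerBl divr_ge0.
Qed.

(** Tonelli: the slice bound [e ^+ 2 / T] integrates over [0,T] to [e ^+ 2]. *)
Lemma distL2_le rho rho' (e : R) : 0 < e ->
  measurable_fun (timeI T `*` unitI) (fun x : R * R => rho x.1 x.2) ->
  measurable_fun (timeI T `*` unitI) (fun x : R * R => rho' x.1 x.2) ->
  (forall t, 0 <= t <= T -> (sqdist (rho t) (rho' t) <= (e ^+ 2 / T)%:E)%E) ->
  (distL2 T rho rho' <= e%:E)%E.
Proof.
move=> e0 mr mr' sq.
have mS : measurable (timeI T `*` @unitI R).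
  by apply: measurableX; exact: measurable_itv.
set D := (fun x : R * R => (rho x.1 x.2 - rho' x.1 x.2)%R) \_ (timeI T `*` unitI).
have mD : measurable_fun setT D.
  by apply/(measurable_restrict _ mS measurableT); rewrite setTI; exact: measurable_funB.
pose h := fun x : R * R => ((D x) ^+ 2)%:E.
have mh : measurable_fun setT h by apply/measurable_EFinP; exact: measurable_funX.
rewrite /distL2 unlock -/D.
have -> : (\int[mu \x mu]_x `|(EFin \o D) x| `^ 2 = \int[mu \x mu]_x h x)%E.
  apply: eq_integral => x _; rewrite /h /= powR_mulrn//.
  by rewrite real_normK// num_real.
have hT : (\int[mu \x mu]_x h x <= (e ^+ 2)%:E)%E.
  rewrite fubini_tonelli1//; last by move=> x; rewrite lee_fin sqr_ge0.
  apply: (@le_trans _ _ (\int[mu]_(t in timeI T) (e ^+ 2 / T)%:E)%E).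
    (* The slices are compared one time at a time, and those outside [0,T] are zero. *)
    rewrite [leRHS]integral_mkcond; apply: ge0_le_integral_nonmeasurable => t _.
      by apply: integral_ge0 => u _; rewrite lee_fin sqr_ge0.
    rewrite /fubini_F /patch; case: ifPn => tT; last first.
      rewrite integral0_eq// => u _; rewrite /h /D /patch ifF ?expr0n//.
      by apply/negbTE; apply: contra tT; rewrite !inE/= => -[].
    move: tT; rewrite inE /timeI/= in_itv/= => tT; apply: le_trans (sq _ tT).
    rewrite /sqdist [leRHS]integral_mkcond le_eqVlt; apply/orP; left; apply/eqP.
    apply: eq_integral => u _; rewrite /h /D /patch.
    have -> : ((t, u) \in timeI T `*` unitI) = (u \in unitI).
      apply/idP/idP; rewrite !inE/=; first by case.
      by split=> //; rewrite /timeI/= in_itv.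
    by case: ifP; rewrite ?expr0n.
  rewrite integral_cst; last exact: measurable_itv.
  rewrite /= /timeI lebesgue_measure_itv/= lte_fin T0 -EFinB -EFinM subr0.
  by rewrite divfK// gt_eqF.
rewrite (_ : e%:E = ((e ^+ 2)%:E `^ 2^-1)%E).
  apply: gt0_ler_poweR => //.
  - by rewrite in_itv/= leey andbT integral_ge0// => x _; rewrite lee_fin sqr_ge0.
  - by rewrite in_itv/= leey andbT lee_fin sqr_ge0.
by rewrite poweR_EFin powR12_sqrt ?sqr_ge0// sqrtr_sqr gtr0_norm.
Qed.

Lemma cvg_distL2 (F : set_system R) (FF : ProperFilter F) (rho : R -> R -> R -> R) rho' :
  (forall e : R, 0 < e -> \forall a \near F, (distL2 T (rho a) rho' <= e%:E)%E) ->
  distL2 T (rho a) rho' @[a --> F] --> 0%E.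
Proof.
move=> H; have d0 a : (0 <= distL2 T (rho a) rho')%E by exact: Lnorm_ge0.
apply/fine_cvgP; split.
  apply: filterS (H 1 ltr01) => a /le_lt_trans; rewrite ge0_fin_numE//; apply.
  exact: ltry.
apply/cvgrPdist_le => e e0; apply: filterS (H e e0) => a da /=.
rewrite sub0r normrN ger0_norm ?fine_ge0// -lee_fin fineK//.
by rewrite ge0_fin_numE// (le_lt_trans da)// ltry.
Qed.

End Limits.

Theorem theorem2p2 (R : realType) (T : R) (rho0 : R -> R)
    (rho : R -> R -> R -> R) (rhoN rhoP : R -> R -> R)
    (T_gt0 : 0 < T)
    (rho0_pc : piecewise_continuous_torus rho0)
    (rho0_01 : forall u : R, 0 <= rho0 u <= 1)
    (rho_01 : forall a t u : R, 0 < a -> 0 <= t <= T -> 0 <= u <= 1 ->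
       0 <= rho a t u <= 1)
    (rho_robin : forall a : R, 0 < a -> weak_robin T rho0 a (rho a))
    (rhoN_neumann : weak_neumann T rho0 rhoN)
    (rhoP_periodic : weak_periodic T rho0 rhoP) :
  distL2 T (rho a) rhoN @[a --> 0^'+] --> 0%E /\
  distL2 T (rho a) rhoP @[a --> +oo] --> 0%E.
Proof.
have mr a : 0 < a ->
    measurable_fun (timeI T `*` unitI) (fun x : R * R => rho a x.1 x.2).
  by move=> /rho_robin[_ []].
split; apply: cvg_distL2 => e e0.
- have [_ [mN _ _ _] _] := rhoN_neumann.
  have A0 : 0 < e ^+ 2 / T / 16 by rewrite !divr_gt0// exprn_gt0.
  near=> a.
  have a0 : 0 < a by near: a; exact: nbhs_right_gt.
  have a1 : a <= 1 by near: a; exact: nbhs_right_le.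
  (* With [a <= 1] this yields [16 * a ^+ 2 <= 16 * a <= e ^+ 2 / T]. *)
  have aA : a <= e ^+ 2 / T / 16 by near: a; exact: nbhs_right_le.
  apply: distL2_le => // [|t tT]; first exact: mr.
  apply: le_trans (robin_neumann_sqdist a0 _ (rho_robin a a0) rhoN_neumann tT) _.
    by move=> s u; exact: rho_01.
  rewrite lee_fin; nra.
- have [_ mP _] := rhoP_periodic.
  have eT : 0 < e ^+ 2 / T by rewrite divr_gt0// exprn_gt0.
  have [A A0 HA] := robin_periodic_sqdist T rho0 eT.
  near=> a.
  have Aa : A <= a by near: a; apply: nbhs_pinfty_ge; exact: num_real.
  have a0 : 0 < a by exact: lt_le_trans Aa.
  apply: distL2_le => // [|t tT]; first exact: mr.
  by apply: (HA a) => //; [move=> s u; exact: rho_01|exact: rho_robin].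
Unshelve. all: by end_near. Qed.
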